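(* Let $\mathcal{N}$ be a nonempty set, $\mathbf{k}$ a field of characteristic zero, and $\lambda\colon\mathcal{N}\to\mathbf{k}$ a map. (i) For every $A^\bullet\in\operatorname{Alt}^\bullet_{\lambda=0}(\mathcal{N})$, there exists a unique pair $(F^\bullet,G^\bullet)$ of alternal moulds such that $$\nabla_\lambda F^\bullet=0,\qquad \nabla_\lambda\big(e^{G^\bullet}\big)=I^\bullet\times e^{G^\bullet}-e^{G^\bullet}\times F^\bullet,\qquad(\ast)$$ $$\mathscr{J}_\lambda(G^\bullet)=A^\bullet.$$ (ii) Suppose that $(F^\bullet,G^\bullet)\in\operatorname{Alt}^\bullet(\mathcal{N})\times\operatorname{Alt}^\bullet(\mathcal{N})$ is a solution of $(\ast)$. Then the formula $$J^\bullet\mapsto(\tilde F^\bullet,\tilde G^\bullet)=\Big(e^{-J^\bullet}\times F^\bullet\times e^{J^\bullet},\ \log\big(e^{G^\bullet}\times e^{J^\bullet}\big)\Big)$$ establishes a one-to-one correspondence between $\operatorname{Alt}^\bullet_{\lambda=0}(\mathcal{N})$ and the set of all solutions $(\tilde F^\bullet,\tilde G^\bullet)\in\operatorname{Alt}^\bullet(\mathcal{N})\times\operatorname{Alt}^\bullet(\mathcal{N})$ of $(\ast)$. Moreover, $$\mathscr{J}_\lambda(\tilde G^\bullet)=e^{-J^\bullet}\times\mathscr{J}_\lambda(G^\bullet)\times e^{J^\bullet}+e^{-J^\bullet}\times\nabla_1\big(e^{J^\bullet}\big).$$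
   Context: Words and moulds. $\underline{\mathcal{N}}$ is the free monoid of words $\underline n=n_1\cdots n_r$ ($r\ge0$, $n_i\in\mathcal{N}$) under concatenation; $\varnothing$ is the empty word and $r(\underline n)$ the length. A mould is a map $M^\bullet\colon\underline{\mathcal{N}}\to\mathbf{k}$, with value $M^{\underline n}$ at $\underline n$. Moulds form an associative algebra $\mathbf{k}^{\underline{\mathcal{N}}}$ for the product $(M^\bullet\times N^\bullet)^{\underline n}=\sum_{\underline n=\underline a\,\underline b}M^{\underline a}N^{\underline b}$ (sum over all decompositions, including $\underline a=\varnothing$ or $\underline b=\varnothing$); the unit is $1^\bullet$, with $1^\varnothing=1$ and $1^{\underline n}=0$ for $\underline n\ne\varnothing$. If $M^\varnothing=0$, then $e^{M^\bullet}=1^\bullet+\sum_{k\ge1}\frac1{k!}(M^\bullet)^{\times k}$ and $\log(1^\bullet+M^\bullet)=\sum_{k\ge1}\frac{(-1)^{k-1}}{k}(M^\bullet)^{\times k}$ (finite sums when evaluated on each word). $I^\bullet$ is the mould with $I^{\underline n}=1$ if $r(\underline n)=1$ and $I^{\underline n}=0$ otherwise. Alternality. For $0\le\ell\le r$, let $\mathfrak{S}_r(\ell)$ be the set of permutations $\tau\in\mathfrak{S}_r$ with $\tau(1)<\cdots<\tau(\ell)$ and $\tau(\ell+1)<\cdots<\tau(r)$. For words $\underline a,\underline b,\underline n$ with $r=r(\underline n)$, $\ell=r(\underline a)$, the shuffling coefficient $\operatorname{sh}(\underline a,\underline b;\underline n)$ is the number of $\tau\in\mathfrak{S}_r(\ell)$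 such that $n_{\tau(1)}\cdots n_{\tau(\ell)}=\underline a$ and $n_{\tau(\ell+1)}\cdots n_{\tau(r)}=\underline b$ (it is $0$ if $r(\underline a)>r(\underline n)$). A mould $M^\bullet$ is alternal if $M^\varnothing=0$ and $\sum_{\underline n\in\underline{\mathcal{N}}}\operatorname{sh}(\underline a,\underline b;\underline n)M^{\underline n}=0$ for any two nonempty words $\underline a,\underline b$. $\operatorname{Alt}^\bullet(\mathcal{N})$ is the set of alternal moulds. Derivations and resonance. A map $\varphi\colon\mathcal{N}\to\mathbf{k}$ is extended to words by $\varphi(\varnothing)=0$, $\varphi(n_1\cdots n_r)=\varphi(n_1)+\cdots+\varphi(n_r)$, and $\nabla_\varphi$ is the derivation of $\mathbf{k}^{\underline{\mathcal{N}}}$ defined by $(\nabla_\varphi M)^{\underline n}=\varphi(\underline n)M^{\underline n}$; in particular $(\nabla_1M)^{\underline n}=r(\underline n)M^{\underline n}$. A mould $M^\bullet$ is $\lambda$-resonant if $\nabla_\lambda M^\bullet=0$; $\operatorname{Alt}^\bullet_{\lambda=0}(\mathcal{N})=\{M^\bullet\in\operatorname{Alt}^\bullet(\mathcal{N}):\nabla_\lambda M^\bullet=0\}$. The $\lambda$-resonant part $[M^\bullet]_{\lambda=0}$ of a mould has value $M^{\underline n}$ at $\underline n$ if $\lambda(\underline n)=0$, and $0$ otherwise. The gauge generator of an alternal mould $M^\bullet$ is $\mathscr{J}_\lambda(M^\bullet)=\big[e^{-M^\bullet}\times\nabla_1(e^{M^\bullet})\big]_{\lambda=0}$. *)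

(* Defs.v *)
From HB Require Import structures.
From mathcomp Require Import all_boot all_order perm all_algebra.
From mathcomp Require Import boolp classical_sets functions cardinality fsbigop.

Set Implicit Arguments.
Unset Strict Implicit.
Unset Printing Implicit Defensive.
Import GRing.Theory.
Local Open Scope ring_scope.
Local Open Scope classical_set_scope.

(* [mould N k] is a definition, not a notation for [seq N -> k]: functions    *)
(* already carry the pointwise product, whereas [*], [1] and [^+] on moulds   *)
(* refer to the (noncommutative) mould product, [mould_mul].                  *)
Definition mould (N : choiceType) (k : fieldType) : Type := seq N -> k.

Section MouldAlgebra.
Variables (N : choiceType) (k : fieldType).
Implicit Types (L M P : mould N k) (c : k) (x : N) (s n : seq N).

HB.instance Definition _ := GRing.Zmodule.copy (mould N k) (seq N -> k).

(* The decompositions n = a b are (take i n, drop i n) for 0 <= i <= size n.  *)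
Definition mould_mul M P : mould N k :=
  fun n => \sum_(i < (size n).+1) M (take i n) * P (drop i n).

Definition mould_one : mould N k := fun n => (n == [::])%:R.

Definition mould_scale c M : mould N k := fun n => c * M n.

Lemma mouldDE M P n : (M + P) n = M n + P n.
Proof. by []. Qed.

Let shift x M : mould N k := fun s => M (x :: s).

Let mul_nil M P : mould_mul M P [::] = M [::] * P [::].
Proof. by rewrite /mould_mul big_ord_recl big_ord0 addr0. Qed.

Let mul_cons M P x s :
  mould_mul M P (x :: s) = M [::] * P (x :: s) + mould_mul (shift x M) P s.
Proof. by rewrite /mould_mul big_ord_recl. Qed.

Let mulDl : left_distributive mould_mul +%R.
Proof.
move=> L M P; apply/funext => n; rewrite mouldDE /mould_mul -big_split /=.
by apply: eq_bigr => i _; rewrite mouldDE mulrDl.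
Qed.

Let mulDr : right_distributive mould_mul +%R.
Proof.
move=> L M P; apply/funext => n; rewrite mouldDE /mould_mul -big_split /=.
by apply: eq_bigr => i _; rewrite mouldDE mulrDr.
Qed.

Let scaleAl c M P :
  mould_scale c (mould_mul M P) = mould_mul (mould_scale c M) P.
Proof.
apply/funext => n; rewrite /mould_scale /mould_mul mulr_sumr.
by apply: eq_bigr => i _; rewrite mulrA.
Qed.

Let scaleAr c M P :
  mould_scale c (mould_mul M P) = mould_mul M (mould_scale c P).
Proof.
apply/funext => n; rewrite /mould_scale /mould_mul mulr_sumr.
by apply: eq_bigr => i _; rewrite mulrCA.
Qed.

Let mulA : associative mould_mul.
Proof.
move=> L M P; apply/funext => n; elim: n L => [|x s IHs] L.
  by rewrite !mul_nil mulrA.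
rewrite mul_cons IHs [RHS]mul_cons mul_nil mul_cons mulrDr mulrA -addrA.
congr (_ + _).
have -> : shift x (mould_mul L M) =
    mould_scale (L [::]) (shift x M) + mould_mul (shift x L) M.
  by apply/funext => t; rewrite /shift mul_cons.
by rewrite mulDl mouldDE -scaleAl.
Qed.

Let mul1 : left_id mould_one mould_mul.
Proof.
move=> M; apply/funext => n; rewrite /mould_mul big_ord_recl.
rewrite take0 drop0 /mould_one eqxx mul1r big1 ?addr0 // => i _.
by case: n i => [[] //|x s] i; rewrite mul0r.
Qed.

Let mulM1 : right_id mould_one mould_mul.
Proof.
move=> M; apply/funext => n; rewrite /mould_mul big_ord_recr /=.
rewrite take_size drop_size /mould_one eqxx mulr1 big1 ?add0r // => i _.
by rewrite -size_eq0 size_drop subn_eq0 leqNgt ltn_ord mulr0.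
Qed.

Let one_neq0 : mould_one != 0.
Proof.
apply/eqP => /(congr1 (fun M => M [::])); rewrite /mould_one eqxx => /eqP.
by rewrite oner_eq0.
Qed.

HB.instance Definition _ := GRing.Zmodule_isNzRing.Build (mould N k)
  mulA mul1 mulM1 mulDl mulDr one_neq0.

Let scaleA a b M : mould_scale a (mould_scale b M) = mould_scale (a * b) M.
Proof. by apply/funext => n; rewrite /mould_scale mulrA. Qed.

Let scale1 : left_id 1 mould_scale.
Proof. by move=> M; apply/funext => n; rewrite /mould_scale mul1r. Qed.

Let scaleDr : right_distributive mould_scale +%R.
Proof.
by move=> c M P; apply/funext => n; rewrite /mould_scale !mouldDE mulrDr.
Qed.

Let scaleDl M : {morph mould_scale^~ M : a b / a + b}.
Proof. by move=> a b; apply/funext => n; rewrite /mould_scale mouldDE mulrDl. Qed.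

HB.instance Definition _ := GRing.Zmodule_isLmodule.Build k (mould N k)
  scaleA scale1 scaleDr scaleDl.

HB.instance Definition _ :=
  GRing.Lmodule_isLalgebra.Build k (mould N k) scaleAl.

HB.instance Definition _ :=
  GRing.Lalgebra_isAlgebra.Build k (mould N k) scaleAr.

Lemma mould1E n : (1 : mould N k) n = (n == [::])%:R.
Proof. by []. Qed.

Lemma mouldME M P n :
  (M * P) n = \sum_(i < (size n).+1) M (take i n) * P (drop i n).
Proof. by []. Qed.

Lemma mouldZE c M n : (c *: M) n = c * M n.
Proof. by []. Qed.

Lemma mouldX_eq0 M j n : M [::] = 0 -> (size n < j)%N -> (M ^+ j) n = 0.
Proof.
move=> M0; elim: j n => // j IHj n nj; rewrite exprS mouldME big1 // => i _.
have [i0|i_gt0] := posnP i; first by rewrite i0 take0 M0 mul0r.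
rewrite IHj ?mulr0 // size_drop.
by rewrite -ltnS (leq_trans _ nj) // ltnS ltn_subrL i_gt0 (leq_trans i_gt0) // -ltnS.
Qed.

(* By [mouldX_eq0], when M [::] = 0 the terms of index j > size n of the      *)
(* exponential and logarithmic series vanish at n, so truncating the series   *)
(* at j = size n loses nothing.                                               *)
Definition mexp M : mould N k :=
  fun n => (1 : mould N k) n
           + \sum_(1 <= j < (size n).+1) (j`!%:R)^-1 * (M ^+ j) n.

(* [mlog L] is log (1 + M) for M = L - 1; it is meaningful when L [::] = 1.   *)
Definition mlog L : mould N k :=
  fun n => \sum_(1 <= j < (size n).+1) (-1) ^+ j.-1 / j%:R * ((L - 1) ^+ j) n.

Definition mouldI : mould N k := fun n => (size n == 1)%N%:R.

(* With positions numbered from 0, 'S_r(l) consists of the permutations that  *)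
(* are increasing on {i | i < l} and on {i | l <= i}.                         *)
Definition shuffle_perms (r l : nat) : {set 'S_r} :=
  [set t : 'S_r | [forall i : 'I_r, forall j : 'I_r,
     ((i < j < l) || (l <= i < j))%N ==> (t i < t j)%N]]%SET.

Definition perm_word n (t : 'S_(size n)) : seq N :=
  [seq tnth (in_tuple n) (t i) | i <- enum 'I_(size n)].

(* If size a > size n then [take (size a) _ == a] fails, so sh a b n = 0.     *)
Definition sh (a b n : seq N) : nat :=
  #|[set t in shuffle_perms (size n) (size a) |
      (take (size a) (perm_word t) == a) &&
      (drop (size a) (perm_word t) == b)]%SET|.

(* The support of [sh a b] is finite, so that the sum over all words in the   *)
(* definition of alternality is a genuine finite sum.                         *)
Lemma finite_sh (a b : seq N) : finite_set [set n | sh a b n != 0].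
Proof.
apply: (@sub_finite_set _ _ [set` permutations (a ++ b)]) => [n /=|].
  rewrite -lt0n => /card_gt0P[t]; rewrite !inE => /and3P[_ /eqP ta /eqP tb].
  rewrite mem_permutations -ta -tb cat_take_drop /perm_word perm_sym.
  apply/(@tuple_permP _ _ _ (in_tuple n)); exists t.
  by [].
exact: finite_seq.
Qed.

Definition Alt : set (mould N k) :=
  [set M : mould N k | M [::] = 0 /\
    forall a b : seq N, a <> [::] -> b <> [::] ->
      \sum_(n \in [set: seq N]) (sh a b n)%:R * M n = 0].

Definition word_sum (phi : N -> k) n : k := \sum_(x <- n) phi x.

Definition nabla (phi : N -> k) M : mould N k := fun n => word_sum phi n * M n.

Definition Alt_res (lam : N -> k) : set (mould N k) :=
  [set M | Alt M /\ nabla lam M = 0].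

Definition res_part (lam : N -> k) M : mould N k :=
  fun n => if word_sum lam n == 0 then M n else 0.

Definition gauge_gen (lam : N -> k) M : mould N k :=
  res_part lam (mexp (- M) * nabla (fun=> 1) (mexp M)).

Definition mould_eqn (lam : N -> k) (F G : mould N k) : Prop :=
  nabla lam F = 0 /\ nabla lam (mexp G) = mouldI * mexp G - mexp G * F.

Definition alt_solutions (lam : N -> k) : set (mould N k * mould N k) :=
  [set FG | [/\ Alt FG.1, Alt FG.2 & mould_eqn lam FG.1 FG.2]].

End MouldAlgebra.

Arguments mouldI {N k}.
Arguments Alt {N k}.

(* Main.v *)
Require Import Defs.
From HB Require Import structures.
From mathcomp Require Import all_boot all_order perm all_algebra.
From mathcomp Require Import boolp classical_sets functions cardinality fsbigop.
From mathcomp Require Import ring.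

Set Implicit Arguments.
Unset Strict Implicit.
Unset Printing Implicit Defensive.
Import GRing.Theory.
Local Open Scope ring_scope.
Local Open Scope classical_set_scope.

(** A mould of constant term zero raises lengths, so everything below is solved
    length by length; [vanish r] is the r-th step of the filtration by length
    and, in characteristic zero, the Euler derivation nabla_1 (multiplication
    by the length) can be inverted on it.

    Alternality and its multiplicative counterpart, symmetrality, are statements
    about the coproduct [copr], the transpose of the shuffle of words:
    alternal moulds are its primitive elements and symmetral ones its group-like
    elements.  Since the coproduct is multiplicative ([coprM]), symmetral moulds
    are closed under products and conjugate alternal moulds to alternal moulds;
    exponential and logarithm exchange the two classes ([mexp_symmetral],
    [mlog_Alt]).

    Part (ii), [gauge_set_bij].  If (F, G) and (F', G') are solutions, then
    S = e^(-G) e^(G') is symmetral and nabla_lam S = F S - S F'.  As F and F' are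
    resonant and have no constant term, an induction on the length shows that S
    vanishes on words of nonzero weight ([ode_resonant]).  Hence S = e^J with J
    alternal and resonant, and F S = S F'.  The formula for the gauge generator
    ([gauge_genM]) is the Leibniz rule, resonant factors going through the
    resonant part.

    Part (i), uniqueness.  By part (ii), two solutions with gauge generator A
    differ by some J with nabla_1 e^J = e^J A - A e^J.  The right-hand side at a
    word only involves the values of e^J - 1 at shorter words, so e^J = 1.

    Part (i), existence, [solution_exists].  Put S = e^G and
    P = S^(-1) nabla_1 S.  Since nabla_1 and nabla_lam commute, applying them
    both to S turns the equation of the theorem into
      nabla_1 F + nabla_lam P = S^(-1) I S + F P - P F.
    Call R this common value.  The first term is supported on words of weight
    zero and the second one on the others, so R determines F, determines P once
    its resonant part is prescribed to be A, and then S.  The right-hand side at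
    a word only involves R at shorter words: this is a fixed point problem for
    R, solvable by iteration ([causal_fixpoint]), and the iteration stays within
    alternal moulds.  The defect D = nabla_lam S - I S + S F of the solution
    obtained satisfies nabla_1 D = D P, whence D = 0. *)

(** * The filtration by length *)

Section Filtration.
Variables (N : choiceType) (k : fieldType).
Implicit Types (M P : mould N k) (n : seq N) (r s : nat).

Definition vanish r M := forall n, (size n < r)%N -> M n = 0.

Lemma vanish0 r : vanish r 0. Proof. by []. Qed.

Lemma vanish_0l M : vanish 0 M. Proof. by []. Qed.

Lemma vanish1P M : vanish 1 M <-> M [::] = 0.
Proof. by split=> [|M0 [|//] _] //; apply. Qed.

Lemma vanishD r M P : vanish r M -> vanish r P -> vanish r (M + P).
Proof. by move=> Mr Pr n nr; rewrite mouldDE Mr ?Pr ?addr0. Qed.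

Lemma vanishN r M : vanish r M -> vanish r (- M).
Proof. by move=> Mr n nr; rewrite -[LHS]/(- (M n)) Mr ?oppr0. Qed.

Lemma vanishB r M P : vanish r M -> vanish r P -> vanish r (M - P).
Proof. by move=> Mr /vanishN; apply: vanishD. Qed.

Lemma vanishM r s M P : vanish r M -> vanish s P -> vanish (r + s) (M * P).
Proof.
move=> Mr Ps n nrs; rewrite mouldME big1 // => i _.
have i_le : (i <= size n)%N by rewrite -ltnS.
have [ir|ri] := ltnP i r; first by rewrite Mr ?mul0r ?size_takel.
rewrite Ps ?mulr0 // size_drop ltn_subLR //.
by rewrite (leq_trans nrs) // leq_add2r.
Qed.

Lemma vanish_leq r s M : (s <= r)%N -> vanish r M -> vanish s M.
Proof. by move=> sr Mr n /leq_trans/(_ sr); apply: Mr. Qed.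

Lemma vanish_eq0 M : (forall r, vanish r M) -> M = 0.
Proof. by move=> M0; apply/funext => n; apply: (M0 (size n).+1). Qed.

Lemma vanish_ind M : vanish 1 M ->
  (forall r, (0 < r)%N -> vanish r M -> vanish r.+1 M) -> M = 0.
Proof.
move=> M1 step; apply: vanish_eq0; case=> [|r]; first exact: vanish_0l.
by elim: r => // r; apply: step.
Qed.

Lemma mouldBE M P n : (M - P) n = M n - P n. Proof. by []. Qed.

Lemma mouldNE M n : (- M) n = - M n. Proof. by []. Qed.

Lemma mould_sumE (I : Type) (t : seq I) (Q : pred I) (F : I -> mould N k) n :
  (\sum_(i <- t | Q i) F i) n = \sum_(i <- t | Q i) F i n.
Proof. by apply: (big_morph (fun M : mould N k => M n)). Qed.

Lemma vanish_eqP r M P :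
  vanish r (M - P) <-> forall n, (size n < r)%N -> M n = P n.
Proof.
split=> MP n nr; first exact/subr0_eq/MP.
by rewrite mouldBE MP ?subrr.
Qed.

Lemma vanishMl r M P : vanish r P -> vanish r (M * P).
Proof. by move=> Pr; rewrite -[r]add0n; apply: vanishM. Qed.

Lemma vanishMr r M P : vanish r M -> vanish r (M * P).
Proof. by move=> Mr; rewrite -[r]addn0; apply: vanishM. Qed.

Lemma vanishX j r M : vanish r M -> vanish (j * r) (M ^+ j).
Proof.
move=> Mr; elim: j => [|j IHj]; first exact: vanish_0l.
by rewrite exprS mulSn; apply: vanishM.
Qed.

Lemma mulrBB M M' P P' : M * P - M' * P' = M * (P - P') + (M - M') * P'.
Proof. by rewrite mulrBr mulrBl addrA subrK. Qed.

Lemma vanish_subM i r M M' P P' : vanish i M -> vanish i P' ->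
  vanish r (M - M') -> vanish r (P - P') -> vanish (i + r) (M * P - M' * P').
Proof.
move=> Mi Pi MM' PP'; rewrite mulrBB.
by apply: vanishD; [|rewrite addnC]; apply: vanishM.
Qed.

Lemma vanish_eqM r M M' P P' :
  vanish r (M - M') -> vanish r (P - P') -> vanish r (M * P - M' * P').
Proof. by rewrite -[r in _ -> _ -> vanish r _]add0n; apply: vanish_subM. Qed.

End Filtration.

(** * Truncated exponential and logarithmic series *)

Section CharZero.
Variables (k : fieldType) (k_char0 : [pchar k] =i pred0).

Lemma natrS_neq0 n : n.+1%:R != 0 :> k.
Proof. by rewrite (pcharf0P k).1. Qed.

Lemma factf_neq0 n : n`!%:R != 0 :> k.
Proof. by rewrite (pcharf0P k).1 // -lt0n fact_gt0. Qed.

Lemma dvd_polyXnP m (p : {poly k}) :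
  reflect (forall i, (i < m)%N -> p`_i = 0) ('X^m %| p).
Proof.
apply: (iffP idP) => [/dvdpP[q ->] i im|p0]; first by rewrite coefMXn im.
have -> : p = drop_poly m p * 'X^m.
  rewrite -[LHS](poly_take_drop m); suff -> : take_poly m p = 0 by rewrite add0r.
  by apply/polyP => i; rewrite coef_take_poly coef0; case: ifP => // /p0.
exact: dvdp_mulIr.
Qed.

(** The differential equation is a first order recursion on coefficients whose
    leading factor i + 1 is invertible.  The identities
    exp (- X) exp X = 1 and exp (log (1 + X)) = 1 + X hold up to degree n for
    the truncated series because both sides solve such an equation. *)
Lemma poly_ode_unique m (c d : k) (U : {poly k}) :
  U`_0 = 0 -> 'X^m %| ((1 + c *: 'X) * U^`() - d *: U) -> 'X^(m.+1) %| U.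
Proof.
move=> U0 /dvd_polyXnP H; apply/dvd_polyXnP; elim=> [//|i IHi]; rewrite ltnS => im.
have ui : U`_i = 0 by apply: IHi; apply: ltnW.
have := H i im; rewrite coefB coefZ ui mulr0 subr0.
rewrite mulrDl mul1r coefD -scalerAl coefZ coefXM coef_deriv.
suff -> : (if i == 0%N then 0 else U^`()`_i.-1) = 0.
  rewrite mulr0 addr0 -mulr_natl => /eqP.
  by rewrite mulf_eq0 (negPf (natrS_neq0 i)) => /eqP.
by case: i ui {IHi im} => // i ui; rewrite /= coef_deriv ui mul0rn.
Qed.

Lemma exprNX j : (- 'X) ^+ j = (-1) ^+ j *: 'X^j :> {poly k}.
Proof. by rewrite -scaleN1r exprZn. Qed.

Definition exp_poly n : {poly k} := \poly_(j < n.+1) j`!%:R^-1.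

(** The term of index 0 is 0 because 0^-1 = 0. *)
Definition log_poly n : {poly k} := \poly_(j < n.+1) ((-1) ^+ j.-1 / j%:R).

Lemma deriv_exp_poly n : (exp_poly n)^`() = exp_poly n - n`!%:R^-1 *: 'X^n.
Proof.
apply/polyP => j; rewrite coef_deriv coefB coefZ coefXn !coef_poly ltnS.
case: (ltngtP j n) => [jn|nj|->]; last 2 first.
- by rewrite ltnNge nj mul0rn mulr0 subr0.
- by rewrite ltnSn mul0rn mulr1 subrr.
rewrite (leqW jn) mulr0 subr0 factS natrM invfM -[LHS]mulr_natl.
by rewrite mulVKf ?natrS_neq0.
Qed.

Lemma deriv_log_poly n : (1 + 'X) * (log_poly n)^`() = 1 - (- 'X) ^+ n.
Proof.
have -> : (log_poly n)^`() = \sum_(j < n) (- 'X) ^+ j.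
  apply/polyP => j; rewrite coef_deriv coef_poly ltnS coef_sum.
  under eq_bigr do rewrite exprNX coefZ coefXn.
  case: ltnP => jn; last first.
    rewrite mul0rn big1 // => i _; rewrite gtn_eqF ?mulr0 //.
    exact: leq_trans jn.
  rewrite (bigD1 (Ordinal jn)) //= eqxx mulr1 big1 ?addr0 => [|i].
    by rewrite -[LHS]mulr_natr mulfVK ?natrS_neq0.
  by rewrite eq_sym -val_eqE /= => /negPf->; rewrite mulr0.
by rewrite -opprB subrX1 -mulNr opprB opprK.
Qed.

Lemma exp_poly_coef0 n : (exp_poly n).[0] = 1.
Proof. by rewrite horner_coef0 coef_poly fact0 invr1. Qed.

Lemma log_poly_coef0 n : (log_poly n).[0] = 0.
Proof. by rewrite horner_coef0 coef_poly invr0 mulr0. Qed.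

Lemma exp_polyN n : 'X^(n.+1) %| (exp_poly n \Po (- 'X)) * exp_poly n - 1.
Proof.
apply: (@poly_ode_unique _ 0 0).
  by rewrite -horner_coef0 !hornerE horner_comp !hornerE oppr0 exp_poly_coef0 mulr1 subrr.
rewrite !scale0r addr0 mul1r subr0 derivB derivC subr0 derivM deriv_comp.
rewrite deriv_exp_poly derivN derivX comp_polyB comp_polyZ comp_Xn_poly.
set E := exp_poly n \Po _; set e := exp_poly n; set c := _^-1.
have -> : (E - c *: (- 'X) ^+ n) * -1 * e + E * (e - c *: 'X^n) =
    ((c * (-1) ^+ n) *: e) * 'X^n - (c *: E) * 'X^n.
  by rewrite exprNX -!mul_polyC ?polyCM; ring.
by rewrite dvdp_sub // dvdp_mull.
Qed.

Lemma exp_polyK n : 'X^(n.+1) %| (exp_poly n \Po log_poly n) - (1 + 'X).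
Proof.
apply: (@poly_ode_unique _ 1 1).
  rewrite -horner_coef0 !hornerE horner_comp log_poly_coef0 exp_poly_coef0.
  by rewrite subrr.
rewrite !scale1r derivB deriv_comp deriv_exp_poly derivD derivX derivC add0r.
rewrite mulrBr mulr1 mulrCA deriv_log_poly comp_polyB comp_polyZ comp_Xn_poly.
set E := exp_poly n \Po _; set c := _^-1.
have Xl : 'X %| log_poly n.
  rewrite -['X]expr1; apply/dvd_polyXnP => -[|//] _.
  by rewrite -horner_coef0 log_poly_coef0.
have -> : (E - c *: log_poly n ^+ n) * (1 - (- 'X) ^+ n) - (1 + 'X) - (E - (1 + 'X))
  = (c *: (- 'X) ^+ n - c%:P) * log_poly n ^+ n - ((-1) ^+ n *: E) * 'X^n.
  by rewrite exprNX -!mul_polyC ?polyCM; ring.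
by rewrite dvdp_sub // dvdp_mull // dvdp_exp2r.
Qed.

End CharZero.

(** * Exponential and logarithm of moulds *)

Section ExpLog.
Variables (N : choiceType) (k : fieldType).
Implicit Types (G H L M P X : mould N k) (n s : seq N) (r : nat).

Lemma mexp_nil M : mexp M [::] = 1.
Proof. by rewrite /mexp big_geq // addr0. Qed.

Lemma mexpE m M n : M [::] = 0 -> (size n <= m)%N ->
  mexp M n = \sum_(j < m.+1) j`!%:R^-1 * (M ^+ j) n.
Proof.
move=> M0 nm; rewrite /mexp -(big_mkord xpredT (fun j => j`!%:R^-1 * (M ^+ j) n)).
rewrite [RHS](big_cat_nat _ (n := (size n).+1)) //= [X in _ = X + _]big_ltn //=.
rewrite fact0 invr1 mul1r expr0.
rewrite [X in _ = _ + X]big_nat [X in _ = _ + X]big1 ?addr0 // => j /andP[nj _].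
by rewrite mouldX_eq0 ?mulr0.
Qed.

Lemma mlogE m L n : L [::] = 1 -> (size n <= m)%N ->
  mlog L n = \sum_(j < m.+1) (-1) ^+ j.-1 / j%:R * ((L - 1) ^+ j) n.
Proof.
move=> L1 nm; pose F j := (-1) ^+ j.-1 / j%:R * ((L - 1) ^+ j) n.
rewrite /mlog -(big_mkord xpredT F).
rewrite [RHS](big_cat_nat _ (n := (size n).+1)) //= [X in _ = X + _]big_ltn //=.
rewrite {1}/F invr0 mulr0 mul0r add0r.
rewrite [X in _ = _ + X]big_nat [X in _ = _ + X]big1 ?addr0 // => j /andP[nj _].
by rewrite /F mouldX_eq0 ?mulr0 // mouldBE L1 mould1E subrr.
Qed.

Lemma mlog_nil L : mlog L [::] = 0.
Proof. by rewrite /mlog big_geq. Qed.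

Lemma horner_alg_poly (a : nat -> k) m M :
  horner_alg M (\poly_(j < m) a j) = \sum_(j < m) a j *: M ^+ j.
Proof.
rewrite poly_def raddf_sum; apply: eq_bigr => j _ /=.
by rewrite linearZ /= rmorphXn /= horner_algX -scalerAl mul1r.
Qed.

Lemma horner_alg_comp M (p q : {poly k}) :
  horner_alg M (p \Po q) = horner_alg (horner_alg M q) p.
Proof.
elim/poly_ind: p => [|p c IHp]; first by rewrite comp_poly0 !rmorph0.
rewrite comp_polyD comp_polyM comp_polyX comp_polyC !rmorphD !rmorphM /= IHp.
by rewrite !horner_algC horner_algX.
Qed.

Lemma horner_alg_vanish m M (p : {poly k}) :
  vanish 1 M -> 'X^m %| p -> vanish m (horner_alg M p).
Proof.
move=> M1 /dvdpP[q ->]; rewrite rmorphM rmorphXn /= horner_algX.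
by apply: vanishMl; rewrite -[m in vanish m]muln1; apply: vanishX.
Qed.

Lemma mexp_horner m M : M [::] = 0 ->
  vanish m.+1 (mexp M - horner_alg M (exp_poly k m)).
Proof.
move=> M0; apply/vanish_eqP => n nm; rewrite (mexpE M0 nm).
by rewrite horner_alg_poly mould_sumE.
Qed.

Lemma mlog_horner m L : L [::] = 1 ->
  vanish m.+1 (mlog L - horner_alg (L - 1) (log_poly k m)).
Proof.
move=> L1; apply/vanish_eqP => n nm; rewrite (mlogE L1 nm).
by rewrite horner_alg_poly mould_sumE.
Qed.

(** Powers of exponent at least 2 only see the difference of G and H through a
    product with a further factor of constant term zero, which gains one
    length: to first order, e^G - e^H is G - H. *)
Lemma mexp_sub r G H : (0 < r)%N -> G [::] = 0 -> H [::] = 0 ->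
  vanish r (G - H) -> vanish r.+1 (mexp G - mexp H - (G - H)).
Proof.
move=> r_gt0 G0 H0 GH; have [G1 H1] := ((vanish1P G).2 G0, (vanish1P H).2 H0).
have powB j : vanish r.+1 (G ^+ j.+2 - H ^+ j.+2).
  elim: j => [|j IHj].
    by rewrite !expr2 -add1n; apply: vanish_subM.
  rewrite exprS [H ^+ _]exprS mulrBB.
  apply: vanishD; first exact: vanishMl.
  rewrite -addn1; apply: vanishM => //; rewrite exprS.
  exact: vanishMr.
move=> n nr; rewrite mouldBE [X in X - _]mouldBE.
have nm : (size n <= r.+1)%N by rewrite ltnW.
rewrite !(mexpE _ nm) // -sumrB !big_ord_recl /= !expr0 !expr1 fact0 invr1 subrr.
rewrite add0r -mulrBr mul1r big1 ?addr0 ?subrr // => j _.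
by rewrite -mulrBr -mouldBE powB ?mulr0.
Qed.

(** By [mexp_sub], an equality of exponentials propagates an agreement of the
    exponents from one length to the next. *)
Lemma mexp_inj G H : G [::] = 0 -> H [::] = 0 -> mexp G = mexp H -> G = H.
Proof.
move=> G0 H0 GH; apply/eqP; rewrite -subr_eq0; apply/eqP/vanish_ind.
  by apply/vanish1P; rewrite mouldBE G0 H0 subrr.
move=> r r_gt0 /(mexp_sub r_gt0 G0 H0).
by rewrite GH subrr sub0r => /vanishN; rewrite opprK.
Qed.

Hypothesis k_char0 : [pchar k] =i pred0.

(** At lengths at most m the exponentials are polynomials in M, so that the
    identity follows from the one for truncated series. *)
Lemma mexpNM M : M [::] = 0 -> mexp (- M) * mexp M = 1.
Proof.
move=> M0; apply/eqP; rewrite -subr_eq0; apply/eqP/vanish_eq0 => -[|m].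
  exact: vanish_0l.
have NM0 : (- M) [::] = 0 by rewrite mouldNE M0 oppr0.
have := vanish_eqM (mexp_horner (m := m) NM0) (mexp_horner (m := m) M0).
have -> : horner_alg (- M) (exp_poly k m) =
          horner_alg M (exp_poly k m \Po (- 'X)).
  by rewrite horner_alg_comp raddfN /= horner_algX.
have := horner_alg_vanish ((vanish1P M).2 M0) (exp_polyN k_char0 m).
rewrite rmorphB rmorph1 rmorphM /= => hp /vanishD/(_ hp).
by rewrite addrA subrK.
Qed.

Lemma mexpMN M : M [::] = 0 -> mexp M * mexp (- M) = 1.
Proof.
by move=> M0; rewrite -{1}[M]opprK mexpNM // mouldNE M0 oppr0.
Qed.

Lemma mlogK L : L [::] = 1 -> mexp (mlog L) = L.
Proof.
move=> L1; apply/eqP; rewrite -subr_eq0; apply/eqP/vanish_eq0 => -[|m].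
  exact: vanish_0l.
have X1 : vanish 1 (L - 1) by apply/vanish1P; rewrite mouldBE L1 mould1E subrr.
have := horner_alg_vanish X1 (exp_polyK k_char0 m).
rewrite rmorphB rmorphD rmorph1 /= horner_algX [1 + _]addrC subrK.
rewrite horner_alg_comp; set X := L - 1; set P := horner_alg X _ => eP.
have mP := mlog_horner (m := m) L1.
have := mexp_horner (m := m) (mlog_nil L).
have : vanish m.+1 (horner_alg (mlog L) (exp_poly k m) - horner_alg P (exp_poly k m)).
  rewrite !horner_alg_poly -sumrB; apply: big_ind => //.
    exact: vanishD.
  move=> j _; rewrite -scalerBr; move=> n nm; rewrite mouldZE.
  suff /(_ n nm) -> : vanish m.+1 (mlog L ^+ j - P ^+ j) by rewrite mulr0.
  elim: (nat_of_ord j) => [|i IHi]; first by rewrite !expr0 subrr.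
  by rewrite exprS [P ^+ _]exprS; apply: vanish_eqM.
by move=> /vanishD/(_ eP) + /vanishD h => /h; rewrite !addrA !subrK.
Qed.

Lemma mexpK M : M [::] = 0 -> mlog (mexp M) = M.
Proof.
move=> M0; apply: mexp_inj; rewrite ?mlog_nil // mlogK //.
exact: mexp_nil.
Qed.

End ExpLog.

(** * Derivations and the Euler equation *)

Section Derivation.
Variables (N : choiceType) (k : fieldType).
Implicit Types (phi : N -> k) (M P : mould N k) (n s : seq N) (r : nat).

Lemma word_sum_nil phi : word_sum phi [::] = 0.
Proof. exact: big_nil. Qed.

Lemma word_sum_cat phi s n : word_sum phi (s ++ n) = word_sum phi s + word_sum phi n.
Proof. exact: big_cat. Qed.

Lemma word_sum1 n : word_sum (fun=> 1) n = (size n)%:R :> k.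
Proof. by rewrite /word_sum big_const_seq count_predT iter_addr_0. Qed.

Lemma nablaE phi M n : nabla phi M n = word_sum phi n * M n.
Proof. by []. Qed.

Lemma nabla1E M n : nabla (fun=> 1) M n = (size n)%:R * M n.
Proof. by rewrite nablaE word_sum1. Qed.

Lemma nablaD phi M P : nabla phi (M + P) = nabla phi M + nabla phi P.
Proof. by apply/funext => n; rewrite mouldDE !nablaE mouldDE mulrDr. Qed.

Lemma nablaB phi M P : nabla phi (M - P) = nabla phi M - nabla phi P.
Proof. by apply/funext => n; rewrite mouldBE !nablaE mouldBE mulrBr. Qed.

Lemma nablaM phi M P : nabla phi (M * P) = nabla phi M * P + M * nabla phi P.
Proof.
apply/funext => n; rewrite nablaE mouldDE !mouldME mulr_sumr -big_split /=.
apply: eq_bigr => i _; rewrite -{1}(cat_take_drop i n) word_sum_cat !nablaE.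
by rewrite mulrDl mulrA [in X in _ + X]mulrCA.
Qed.

Lemma nabla_one phi : nabla phi 1 = 0 :> mould N k.
Proof.
apply/funext => -[|x n]; rewrite nablaE ?word_sum_nil ?mul0r //.
by rewrite mould1E mulr0.
Qed.

Lemma nablaC phi psi M : nabla phi (nabla psi M) = nabla psi (nabla phi M).
Proof. by apply/funext => n; rewrite !nablaE mulrCA. Qed.

Lemma nabla1_I : nabla (fun=> 1) mouldI = mouldI :> mould N k.
Proof.
apply/funext => n; rewrite nabla1E /mouldI.
by case: eqP => [->|]; rewrite ?mul1r ?mulr0.
Qed.

Hypothesis k_char0 : [pchar k] =i pred0.

Lemma nabla1_vanish r M : vanish 1 M -> vanish r (nabla (fun=> 1) M) -> vanish r M.
Proof.
move=> M1 Mr [|x n] nr; first exact: M1.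
have /eqP := Mr _ nr; rewrite nabla1E mulf_eq0 (negPf (natrS_neq0 k_char0 (size n))).
by move/eqP.
Qed.

(** Since P and Q have no constant term, Y * P + Q * Y at a word only involves Y
    at shorter words, while nabla_1 multiplies Y by the nonzero length. *)
Lemma euler_vanish r Y P Q : vanish 1 Y -> vanish 1 P -> vanish 1 Q ->
  vanish r (nabla (fun=> 1) Y - (Y * P + Q * Y)) -> vanish r Y.
Proof.
move=> Y1 P1 Q1; elim: r => [|r IHr] HY; first exact: vanish_0l.
apply: nabla1_vanish => //; rewrite -[nabla _ _](subrK (Y * P + Q * Y)).
have Yr : vanish r Y by apply: IHr; apply: vanish_leq HY.
apply: vanishD => //; apply: vanishD; first by rewrite -addn1; apply: vanishM.
by rewrite -add1n; apply: vanishM.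
Qed.

Lemma euler_unique Y P Q : vanish 1 Y -> vanish 1 P -> vanish 1 Q ->
  nabla (fun=> 1) Y = Y * P + Q * Y -> Y = 0.
Proof.
move=> Y1 P1 Q1 YE; apply: vanish_eq0 => r; apply: (euler_vanish Y1 P1 Q1).
by rewrite YE subrr; apply: vanish0.
Qed.

(** The iterates of [Phi] stabilise on each length, so they converge.  The
    closed set C records a property, such as alternality, that the limit
    inherits. *)
Lemma causal_fixpoint (C : set (mould N k)) (Phi : mould N k -> mould N k) M0 :
    (forall M, (forall r, exists2 P, C P & vanish r (M - P)) -> C M) ->
    (forall M, C M -> C (Phi M)) -> C M0 ->
    (forall r M P, C M -> C P -> vanish r (M - P) ->
       vanish r.+1 (Phi M - Phi P)) ->
  exists2 M, C M & Phi M = M.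
Proof.
move=> Ccl CPhi CM0 causal; pose it m := iter m Phi M0.
have Cit m : C (it m) by elim: m => //= m; apply: CPhi.
have step m : vanish m (it m.+1 - it m).
  by elim: m => [|m IHm]; [exact: vanish_0l | exact: (causal _ _ _ (Cit m.+1) (Cit m) IHm)].
have stab m j : vanish m (it (m + j)%N - it m).
  elim: j => [|j IHj]; first by rewrite addn0 subrr; apply: vanish0.
  rewrite addnS -(subrK (it (m + j)%N) (it _.+1)) -addrA; apply: vanishD => //.
  by apply: (vanish_leq _ (step _)); apply: leq_addr.
pose M : mould N k := fun n => it (size n).+1 n.
have Mit r : vanish r (M - it r).
  apply/vanish_eqP => n nr; have := stab (size n).+1 (r - (size n).+1)%N.
  by rewrite subnKC // => /vanish_eqP/(_ n (ltnSn _)) ->.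
have CM : C M by apply: Ccl => r; exists (it r).
exists M => //; apply/eqP; rewrite -subr_eq0; apply/eqP/vanish_eq0 => -[|r].
  exact: vanish_0l.
have -> : Phi M - M = (Phi M - it r.+1) - (M - it r.+1).
  by rewrite opprB addrA subrK.
by apply: vanishB => //; apply: causal.
Qed.

Lemma nabla1_ode P : vanish 1 P ->
  exists2 S : mould N k, S [::] = 1 & nabla (fun=> 1) S = S * P.
Proof.
move=> P1.
pose Phi S : mould N k := fun n => if n is [::] then 1 else (size n)%:R^-1 * (S * P) n.
have causal r S S' : vanish r (S - S') -> vanish r.+1 (Phi S - Phi S').
  move=> SS' [|x n] nr; rewrite mouldBE ?subrr // -mulrBr -mouldBE -mulrBl.
  suff /(_ _ nr) -> : vanish r.+1 ((S - S') * P) by rewrite mulr0.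
  by rewrite -addn1; apply: vanishM.
have [//|//|//|r S S' _ _|S _ SE] := @causal_fixpoint setT Phi 0.
  exact: causal.
exists S; first by rewrite -SE.
apply/funext => -[|x n]; rewrite nabla1E; last first.
  by rewrite -{1}SE /= mulVKf ?natrS_neq0.
by rewrite mul0r mouldME big_ord_recl big_ord0 /= (P1 [::]) // mulr0 addr0.
Qed.

End Derivation.

(** * Shuffles of words *)

Fixpoint shuffles (T : Type) (a : seq T) : seq T -> seq (seq T) :=
  if a is x :: a' then
    fix shuffles_a b := if b is y :: b' then
      map (cons x) (shuffles a' b) ++ map (cons y) (shuffles_a b') else [:: a]
  else fun b => [:: b].

Lemma shuffles0s (T : Type) (b : seq T) : shuffles [::] b = [:: b].
Proof. by []. Qed.

Lemma shuffless0 (T : Type) (a : seq T) : shuffles a [::] = [:: a].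
Proof. by case: a. Qed.

Lemma shuffles_cons (T : Type) (x y : T) (a b : seq T) :
  shuffles (x :: a) (y :: b) =
  map (cons x) (shuffles a (y :: b)) ++ map (cons y) (shuffles (x :: a) b).
Proof. by []. Qed.

Fixpoint masks (r : nat) : seq bitseq :=
  if r is r'.+1 then map (cons true) (masks r') ++ map (cons false) (masks r')
  else [:: [::]].

Lemma mem_masks r m : (m \in masks r) = (size m == r).
Proof.
have cons_inj (c : bool) : injective (cons c) by move=> ? ? [].
elim: r m => [|r IHr] [|c m] //=; rewrite mem_cat ?eqSS.
  by apply/negP => /orP[] /mapP[].
case: c; rewrite mem_map // IHr.
  suff /negPf -> : true :: m \notin map (cons false) (masks r) by rewrite orbF.
  by apply/negP => /mapP[].
suff /negPf -> : false :: m \notin map (cons true) (masks r) by [].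
by apply/negP => /mapP[].
Qed.

Lemma masks_uniq r : uniq (masks r).
Proof.
have cons_inj (c : bool) : injective (cons c) by move=> ? ? [].
elim: r => //= r IHr; rewrite cat_uniq !map_inj_uniq // IHr andbT /=.
by apply/hasPn => m /mapP[m' _ ->]; apply/negP => /mapP[].
Qed.

(** A mask marks the positions of n that carry the letters of a. *)
Definition extracts (T : eqType) (a b n : seq T) (m : bitseq) :=
  (mask m n == a) && (mask (map negb m) n == b).

(** Both sides obey the same recursion on n: the first letter of n is the first
    letter of a or the first letter of b. *)
Lemma count_masks (T : eqType) (a b n : seq T) :
  count (extracts a b n) (masks (size n)) = count_mem n (shuffles a b).
Proof.
have shuf0 (x : T) l : count_mem [::] (map (cons x) l) = 0%N.
  by rewrite count_map -[RHS](count_pred0 l); apply: eq_count.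
have shufS (x y : T) s l :
    count_mem (x :: s) (map (cons y) l) = ((x == y) * count_mem s l)%N.
  rewrite count_map; have [->|xy] := eqVneq x y.
    by rewrite mul1n; apply: eq_count => w /=; rewrite eqseq_cons eqxx.
  rewrite mul0n -[RHS](count_pred0 l); apply: eq_count => w /=.
  by rewrite eqseq_cons eq_sym (negPf xy).
have cntT l a' b' x s : count (preim (cons true) (extracts a' b' (x :: s))) l =
    if a' is u :: a'' then ((x == u) * count (extracts a'' b' s) l)%N else 0%N.
  case: a' => [|u a''].
    by rewrite -[RHS](count_pred0 l); apply: eq_count => m; rewrite /extracts.
  have [<-|xu] := eqVneq x u.
    by rewrite mul1n; apply: eq_count => m; rewrite /extracts /= eqseq_cons eqxx.
  rewrite -[RHS](count_pred0 l); apply: eq_count => m.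
  by rewrite /extracts /= eqseq_cons (negPf xu).
have cntF l a' b' x s : count (preim (cons false) (extracts a' b' (x :: s))) l =
    if b' is v :: b'' then ((x == v) * count (extracts a' b'' s) l)%N else 0%N.
  case: b' => [|v b''].
    by rewrite -[RHS](count_pred0 l); apply: eq_count => m; rewrite /extracts /= andbF.
  have [<-|xv] := eqVneq x v.
    by rewrite mul1n; apply: eq_count => m; rewrite /extracts /= eqseq_cons eqxx.
  rewrite -[RHS](count_pred0 l); apply: eq_count => m.
  by rewrite /extracts /= eqseq_cons (negPf xv) andbF.
elim: n a b => [|x n IHn] a b.
  rewrite /extracts /=; case: a => [|u a]; case: b => [|v b] //=.
  by rewrite count_cat !shuf0.
rewrite [masks _]/= count_cat !count_map cntT cntF.
case: a => [|u a]; case: b => [|v b].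
- by [].
- by rewrite IHn /= eqseq_cons (eq_sym v) !addn0 add0n mulnb.
- by rewrite IHn shuffless0 /= eqseq_cons (eq_sym u) !addn0 mulnb.
by rewrite shuffles_cons count_cat !shufS !IHn.
Qed.

Section ShuffleCount.
Variables (N : choiceType) (n : seq N) (l : nat).
Let r := size n.
Let ltI : rel 'I_r := fun i j => (i < j)%N.

Let ltI_trans : transitive ltI.
Proof. by move=> j i h; apply: ltn_trans. Qed.

Let ltI_irr : irreflexive ltI.
Proof. by move=> i; apply: ltnn. Qed.

Let ltI_enum : sorted ltI (enum 'I_r).
Proof.
by have := iota_ltn_sorted 0 r; rewrite -val_enum_ord sorted_map.
Qed.

Let ltI_map_lt (t : 'I_r -> 'I_r) s i j : sorted ltI s -> sorted ltI (map t s) ->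
  i \in s -> j \in s -> (i < j)%N -> (t i < t j)%N.
Proof.
move=> ss; rewrite sorted_map => sts si sj ij.
apply: (@sorted_ltn_index _ (relpre t ltI) _ s sts _ _ si sj) => [u v w|].
  exact: ltI_trans.
rewrite ltnNge leq_eqVlt; apply/negP => /orP[/eqP ji|].
  by move: ij; rewrite (index_inj i sj si ji) ltnn.
move/(sorted_ltn_index ltI_trans ss j i sj si) => ji.
by have := ltn_trans ij ji; rewrite ltnn.
Qed.

Let low i := (i < l)%N.

Lemma take_enum_ord : take l (enum 'I_r) = [seq i <- enum 'I_r | low (val i)].
Proof.
apply: (irr_sorted_eq ltI_trans ltI_irr).
- exact: take_sorted ltI_enum.
- exact: (sorted_filter ltI_trans _ ltI_enum).
by move=> i; rewrite mem_filter mem_enum andbT in_take ?mem_enum ?index_enum_ord.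
Qed.

Lemma drop_enum_ord : drop l (enum 'I_r) = [seq i <- enum 'I_r | ~~ low (val i)].
Proof.
apply: (irr_sorted_eq ltI_trans ltI_irr).
- exact: drop_sorted ltI_enum.
- exact: (sorted_filter ltI_trans _ ltI_enum).
move=> i; rewrite mem_filter mem_enum andbT.
have -> : low (val i) = (i \in take l (enum 'I_r)).
  by rewrite in_take ?mem_enum ?index_enum_ord.
have := enum_uniq 'I_r; have : i \in enum 'I_r by rewrite mem_enum.
rewrite -{1 2}(cat_take_drop l (enum 'I_r)) mem_cat cat_uniq.
move=> + /and3P[_ /hasPn dis _].
by case: (boolP (i \in drop _ _)) => [/dis/negPf /= ->|_] //; rewrite orbF => ->.
Qed.

(** The image under t of the first l positions, as a mask. *)
Definition perm_mask (t : 'S_r) := [seq low (val (t^-1 i)%g) | i <- enum 'I_r].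

Lemma shuffle_permsP (t : 'S_r) : reflect
  (sorted ltI (map t (take l (enum 'I_r))) /\ sorted ltI (map t (drop l (enum 'I_r))))
  (t \in shuffle_perms r l).
Proof.
rewrite inE take_enum_ord drop_enum_ord; apply: (iffP forallP) => [H|[st sd] i].
  have mono (i j : 'I_r) : ((i < j < l) || (l <= i < j))%N -> (t i < t j)%N.
    by move=> ij; have /forallP/(_ j)/implyP := H i; apply.
  split.
    apply: (homo_sorted_in (P := fun i => low (val i)) (e := ltI)).
    - by move=> i j _ lj ij; apply: mono; rewrite [(i < j)%N]ij [(j < l)%N]lj.
    - exact: filter_all.
    exact: (sorted_filter ltI_trans _ ltI_enum).
  apply: (homo_sorted_in (P := fun i => ~~ low (val i)) (e := ltI)).
  - move=> i j; rewrite -!topredE /= /low -!leqNgt => li _ ij.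
    by apply: mono; rewrite li [(i < j)%N]ij orbT.
  - exact: filter_all.
  exact: (sorted_filter ltI_trans _ ltI_enum).
apply/forallP => j; apply/implyP => /orP[/andP[ij jl]|/andP[li ij]].
  apply: (ltI_map_lt _ st) => //; first exact: (sorted_filter ltI_trans _ ltI_enum).
    by rewrite mem_filter mem_enum andbT; apply: ltn_trans jl.
  by rewrite mem_filter mem_enum andbT.
apply: (ltI_map_lt _ sd) => //; first exact: (sorted_filter ltI_trans _ ltI_enum).
  by rewrite mem_filter mem_enum andbT /low -leqNgt.
by rewrite mem_filter mem_enum andbT /low -leqNgt (leq_trans li) // ltnW.
Qed.

(** A shuffle permutation is increasing on the first l positions, so it lists
    their image in increasing order, which is what a mask extracts; likewise
    for the other positions.  Hence it is determined by its mask. *)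
Lemma shuffle_perm_take (t : 'S_r) : t \in shuffle_perms r l ->
  map t (take l (enum 'I_r)) = mask (perm_mask t) (enum 'I_r).
Proof.
case/shuffle_permsP => st _; rewrite -filter_mask.
apply: (irr_sorted_eq ltI_trans ltI_irr) => //.
  exact: (sorted_filter ltI_trans _ ltI_enum).
move=> i; rewrite mem_filter mem_enum andbT take_enum_ord.
rewrite -[i in LHS](permKV t) mem_map; last exact: perm_inj.
by rewrite mem_filter mem_enum andbT.
Qed.

Lemma shuffle_perm_drop (t : 'S_r) : t \in shuffle_perms r l ->
  map t (drop l (enum 'I_r)) = mask (map negb (perm_mask t)) (enum 'I_r).
Proof.
case/shuffle_permsP => _ sd; rewrite -map_comp -filter_mask.
apply: (irr_sorted_eq ltI_trans ltI_irr) => //.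
  exact: (sorted_filter ltI_trans _ ltI_enum).
move=> i; rewrite mem_filter mem_enum andbT drop_enum_ord.
rewrite -[i in LHS](permKV t) mem_map; last exact: perm_inj.
by rewrite mem_filter mem_enum andbT.
Qed.

Lemma mask_shuffle (m : bitseq) : size m = r -> count id m = l ->
  exists2 t : 'S_r, t \in shuffle_perms r l & perm_mask t = m.
Proof.
move=> mr ml; pose e := enum 'I_r; pose ts := mask m e ++ mask (map negb m) e.
have me : size m = size e by rewrite size_enum_ord.
have tsP : ts = [seq i <- e | nth false m (val i)] ++
                [seq i <- e | ~~ nth false m (val i)].
  rewrite /ts !mask_enum_ord; congr (_ ++ _); apply: eq_filter => i /=.
  by rewrite (nth_map false) ?mr.
have : perm_eq ts (ord_tuple r).
  by rewrite val_ord_tuple -/e tsP; apply/permPl/perm_filterC.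
case/tuple_permP => t tE.
have {tE} tE : map t e = ts by rewrite tE; apply: eq_map => i; rewrite tnth_ord_tuple.
have tl : map t (take l e) = mask m e.
  by rewrite map_take tE /ts take_size_cat // size_mask.
have td : map t (drop l e) = mask (map negb m) e.
  by rewrite map_drop tE /ts drop_size_cat // size_mask.
exists t.
  by apply/shuffle_permsP; rewrite tl td; split; apply: sorted_mask ltI_enum.
have -> : perm_mask t = map (nth false m \o val) e.
  apply: eq_map => i /=; have -> : low (t^-1 i)%g = (i \in map t (take l e)).
    rewrite -[i in RHS](permKV t) mem_map; last exact: perm_inj.
    by rewrite take_enum_ord mem_filter mem_enum andbT.
  by rewrite tl mask_enum_ord mem_filter mem_enum andbT.
by rewrite map_comp val_enum_ord -mr; apply: mkseq_nth.
Qed.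

End ShuffleCount.

(** Shuffle permutations correspond to masks, which [count_masks] relates to the
    recursive definition of shuffles. *)
Lemma sh_count (N : choiceType) (a b n : seq N) :
  sh a b n = count_mem n (shuffles a b).
Proof.
rewrite -count_masks /sh cardE -(size_map (perm_mask (size a))) -size_filter.
have permW (t : 'S_(size n)) : t \in shuffle_perms (size n) (size a) ->
    take (size a) (perm_word t) = mask (perm_mask (size a) t) n /\
    drop (size a) (perm_word t) = mask (map negb (perm_mask (size a) t)) n.
  move=> tsh; rewrite /perm_word (map_comp (tnth _) t) -2!map_take -2!map_drop.
  have := congr1 (map (tnth (in_tuple n))) (shuffle_perm_take tsh).
  have := congr1 (map (tnth (in_tuple n))) (shuffle_perm_drop tsh).
  by rewrite !map_mask map_tnth_enum => <- <-.
apply/perm_size/uniq_perm.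
- rewrite map_inj_in_uniq ?enum_uniq // => t u.
  rewrite !mem_enum finset.in_set => /andP[tsh _] + tu.
  rewrite finset.in_set => /andP[ush _].
  have : map t (enum 'I_(size n)) = map u (enum 'I_(size n)).
    rewrite -(cat_take_drop (size a) (enum _)) !map_cat.
    rewrite (shuffle_perm_take tsh) (shuffle_perm_drop tsh).
    by rewrite (shuffle_perm_take ush) (shuffle_perm_drop ush) tu.
  by move=> /eq_in_map tuE; apply/permP => i; apply: tuE; rewrite mem_enum.
- by rewrite filter_uniq ?masks_uniq.
move=> m; rewrite mem_filter mem_masks; apply/mapP/andP => [[t + ->]|[]].
  rewrite mem_enum finset.in_set => /andP[tsh]; have [-> ->] := permW t tsh.
  by rewrite size_map size_enum_ord eqxx.
move=> /andP[/eqP ma /eqP mb] /eqP mn.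
have ml : count id m = size a by rewrite -ma size_mask.
have [t tsh tm] := mask_shuffle mn ml; exists t => //.
have [ta tb] := permW t tsh; rewrite mem_enum finset.in_set tsh ta tb tm.
by rewrite ma mb !eqxx.
Qed.

(** * The coproduct *)

(** A function of two words; [copr M] plays the part of an element of the
    completed tensor square of moulds, and [dmul] is the product of that
    algebra. *)
Definition dimould (N : choiceType) (k : fieldType) : Type := seq N -> mould N k.

Section Coproduct.
Variables (N : choiceType) (k : fieldType).

HB.instance Definition _ := GRing.Zmodule.copy (dimould N k) (seq N -> mould N k).

Implicit Types (A B C : dimould N k) (M P Q R S : mould N k) (a b n : seq N).

Definition dmul A B : dimould N k := fun a b =>
  \sum_(i < (size a).+1) \sum_(j < (size b).+1)
    A (take i a) (take j b) * B (drop i a) (drop j b).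

Definition tens M P : dimould N k := fun a b => M a * P b.

Definition copr M : dimould N k := fun a b => \sum_(n <- shuffles a b) M n.

Lemma dimouldDE A B a b : (A + B) a b = A a b + B a b. Proof. by []. Qed.

Lemma dimouldNE A a b : (- A) a b = - A a b. Proof. by []. Qed.

Lemma dmulDl A B C : dmul (A + B) C = dmul A C + dmul B C.
Proof.
apply/funext => a; apply/funext => b; rewrite dimouldDE /dmul -big_split.
apply: eq_bigr => i _; rewrite -big_split; apply: eq_bigr => j _.
by rewrite dimouldDE mulrDl.
Qed.

Lemma dmulDr A B C : dmul A (B + C) = dmul A B + dmul A C.
Proof.
apply/funext => a; apply/funext => b; rewrite dimouldDE /dmul -big_split.
apply: eq_bigr => i _; rewrite -big_split; apply: eq_bigr => j _.
by rewrite dimouldDE mulrDr.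
Qed.

Lemma dmul_tens M P Q R : dmul (tens M P) (tens Q R) = tens (M * Q) (P * R).
Proof.
apply/funext => a; apply/funext => b; rewrite /tens !mouldME big_distrlr /=.
by apply: eq_bigr => i _; apply: eq_bigr => j _; rewrite mulrACA.
Qed.

Lemma tensDl M P Q : tens (M + P) Q = tens M Q + tens P Q.
Proof. by apply/funext => a; apply/funext => b; apply: mulrDl. Qed.

Lemma tensDr M P Q : tens M (P + Q) = tens M P + tens M Q.
Proof. by apply/funext => a; apply/funext => b; apply: mulrDr. Qed.

Lemma tensNl M P : tens (- M) P = - tens M P.
Proof. by apply/funext => a; apply/funext => b; apply: mulNr. Qed.

Lemma tensNr M P : tens M (- P) = - tens M P.
Proof. by apply/funext => a; apply/funext => b; apply: mulrN. Qed.

Lemma coprD M P : copr (M + P) = copr M + copr P.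
Proof. by apply/funext => a; apply/funext => b; apply: big_split. Qed.

Lemma coprN M : copr (- M) = - copr M.
Proof. by apply/funext => a; apply/funext => b; apply: sumrN. Qed.

Lemma copr0s M b : copr M [::] b = M b.
Proof. by rewrite /copr shuffles0s big_seq1. Qed.

Lemma coprs0 M a : copr M a [::] = M a.
Proof. by rewrite /copr shuffless0 big_seq1. Qed.

Let shift x M : mould N k := fun n => M (x :: n).

Lemma copr_cons M x y a b :
  copr M (x :: a) (y :: b) = copr (shift x M) a (y :: b) + copr (shift y M) (x :: a) b.
Proof. by rewrite /copr shuffles_cons big_cat !big_map. Qed.

Let shiftM x M P : shift x (M * P) = M [::] *: shift x P + shift x M * P.
Proof. by apply/funext => n; rewrite /shift mouldME big_ord_recl. Qed.

Lemma coprZ c M : forall a b, copr (c *: M) a b = c * copr M a b.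
Proof. by move=> a b; rewrite /copr mulr_sumr. Qed.

(** The concatenation product is compatible with the shuffle: cutting a shuffle
    of a and b into two pieces amounts to cutting both a and b and shuffling
    the pieces.  Formally, an induction on a and b along the recursion that
    removes the first letter. *)
Lemma coprM M P : copr (M * P) = dmul (copr M) (copr P).
Proof.
apply/funext => a; apply/funext => b; elim: a b M => [|x a IHa] b M.
  rewrite copr0s mouldME /dmul [RHS]big_ord_recl big_ord0 addr0.
  by apply: eq_bigr => j _; rewrite !copr0s.
elim: b M => [|y b IHb] M.
  rewrite coprs0 mouldME /dmul; apply: eq_bigr => i _.
  by rewrite [RHS]big_ord_recl big_ord0 addr0 !coprs0.
rewrite copr_cons !shiftM !coprD !dimouldDE !coprZ IHa IHb addrACA -mulrDr -copr_cons.
rewrite /dmul [RHS]big_ord_recl /= [X in _ = X + _]big_ord_recl /= coprs0 -addrA.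
(* The terms with an empty prefix of a or of b are matched one by one; in the
   others [copr_cons] applies to the two nonempty prefixes. *)
congr (_ + _); rewrite addrC [X in X + _ = _]big_ord_recl /= -addrA.
congr (_ + _); first by apply: eq_bigr => j _; rewrite /= !copr0s.
rewrite -big_split; apply: eq_bigr => i _ /=.
rewrite [RHS]big_ord_recl [X in _ + X = _]big_ord_recl /= !coprs0 addrCA; congr (_ + _).
rewrite -big_split; apply: eq_bigr => j _ /=.
by rewrite copr_cons mulrDl addrC.
Qed.

Lemma copr1 : copr 1 = tens 1 1.
Proof.
apply/funext => -[|x a]; apply/funext => -[|y b]; rewrite /tens ?copr0s ?coprs0;
  rewrite ?mould1E ?mul1r ?mul0r //.
by rewrite copr_cons /copr !big1 ?addr0.
Qed.

Lemma shuffles_perm a b n : n \in shuffles a b -> perm_eq n (a ++ b).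
Proof.
elim: a b n => [|x a IHa] b n; first by rewrite inE => /eqP->.
elim: b n => [|y b IHb] n; first by rewrite shuffless0 inE cats0 => /eqP->.
rewrite shuffles_cons mem_cat => /orP[] /mapP[s].
  by move=> /IHa sab ->; rewrite /= perm_cons.
move=> /IHb sab ->; rewrite -cat1s perm_sym.
by rewrite -[y :: b]cat1s perm_catCA perm_cat2l perm_sym.
Qed.

Lemma eq_copr M P a b : (forall n, size n = (size a + size b)%N -> M n = P n) ->
  copr M a b = copr P a b.
Proof.
move=> MP; apply: eq_big_seq => n /shuffles_perm/perm_size.
by rewrite size_cat => /MP.
Qed.

Lemma copr_sh M a b : \sum_(n \in [set: seq N]) (sh a b n)%:R * M n = copr M a b.
Proof.
rewrite (fsbigE (undup (shuffles a b))) ?undup_uniq // => [|n _]; last first.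
  by rewrite mem_undup sh_count => /count_memPn ->; rewrite mul0r.
rewrite /copr -[RHS]big_undup_iterop_count; apply: eq_big => n; first exact: in_setT.
by rewrite sh_count mulr_natl.
Qed.

End Coproduct.

(** * Alternal and symmetral moulds *)

Section Alternal.
Variables (N : choiceType) (k : fieldType).
Implicit Types (M P Q R S T F G H J : mould N k) (a b n : seq N) (r : nat).

Lemma AltE M : Alt M <-> M [::] = 0 /\
  forall a b, a != [::] -> b != [::] -> copr M a b = 0.
Proof.
split=> -[M0 MA]; split=> // a b.
  by move=> /eqP a0 /eqP b0; rewrite -copr_sh MA.
by move=> /eqP a0 /eqP b0; rewrite copr_sh MA.
Qed.

(** Alternal moulds are the primitive elements; the terms M (x) 1 and 1 (x) M
    account for the pairs with an empty word. *)
Lemma AltP M : Alt M <-> copr M = tens M 1 + tens 1 M.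
Proof.
rewrite AltE; split=> [[M0 MA]|ME].
  apply/funext => a; apply/funext => b; rewrite dimouldDE /tens !mould1E.
  have [->|a0] := eqVneq a [::]; first by rewrite copr0s M0 mul0r add0r mul1r.
  have [->|b0] := eqVneq b [::]; first by rewrite coprs0 mul0r addr0 mulr1.
  by rewrite MA // mulr0 mul0r addr0.
split=> [|a b a0 b0]; last first.
  by rewrite ME dimouldDE /tens !mould1E (negPf a0) (negPf b0) mulr0 mul0r addr0.
have /eqP := congr1 (fun A => A [::] [::]) ME.
by rewrite dimouldDE /tens copr0s mould1E mulr1 mul1r -subr_eq0 opprD addNKr oppr_eq0 => /eqP.
Qed.

Definition symmetral S := S [::] = 1 /\ copr S = tens S S.

Lemma Alt0 : Alt (0 : mould N k).
Proof. by apply/AltE; split=> // a b _ _; rewrite /copr big1. Qed.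

Lemma AltN M : Alt M -> Alt (- M).
Proof. by move=> /AltP ME; apply/AltP; rewrite coprN ME opprD tensNl tensNr. Qed.

Lemma AltD M P : Alt M -> Alt P -> Alt (M + P).
Proof.
move=> /AltP ME /AltP PE; apply/AltP.
by rewrite coprD ME PE tensDl tensDr addrACA.
Qed.

Lemma Alt_nil M : Alt M -> M [::] = 0.
Proof. by case. Qed.

Lemma Alt_vanish M : Alt M -> vanish 1 M.
Proof. by move/Alt_nil/vanish1P. Qed.

Lemma Alt_bracket M P : Alt M -> Alt P -> Alt (M * P - P * M).
Proof.
move=> /AltP ME /AltP PE; apply/AltP.
rewrite coprD coprN !coprM ME PE !(dmulDl, dmulDr) !dmul_tens !mulr1 !mul1r.
rewrite tensDl tensDr tensNl tensNr.
(* The mixed terms M (x) P and P (x) M cancel. *)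
apply/funext => a; apply/funext => b; rewrite !(dimouldDE, dimouldNE).
by ring.
Qed.

Lemma Alt_conj S T M : symmetral S -> symmetral T -> T * S = 1 -> Alt M ->
  Alt (T * M * S).
Proof.
move=> [_ SE] [_ TE] TS /AltP ME; apply/AltP.
by rewrite !coprM SE TE ME !(dmulDl, dmulDr) !dmul_tens !mulr1 TS.
Qed.

(** All the shuffles of a and b are permutations of one word, so a weight that
    ignores the order of letters factors out of the coproduct. *)
Lemma Alt_weight (c : seq N -> k) M : (forall s n, perm_eq s n -> c s = c n) ->
  Alt M -> Alt (fun n => c n * M n : k).
Proof.
move=> cP /AltE[M0 MA]; apply/AltE; split=> [|a b a0 b0]; first by rewrite M0 mulr0.
rewrite -[RHS](mulr0 (c (a ++ b))) -(MA a b a0 b0) /copr mulr_sumr.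
by apply: eq_big_seq => n /shuffles_perm/cP ->.
Qed.

(** Each alternality condition involves words of a single length. *)
Lemma Alt_closed M : (forall r, exists2 P, Alt P & vanish r (M - P)) -> Alt M.
Proof.
move=> appr; apply/AltE; split=> [|a b a0 b0].
  by have [P PA /vanish_eqP ->] := appr 1%N; rewrite ?(Alt_nil PA).
have [P /AltE[_ PA] /vanish_eqP MP] := appr (size a + size b).+1.
by rewrite -(PA a b a0 b0); apply: eq_copr => n nab; rewrite MP // nab.
Qed.

Lemma Alt_I : Alt (mouldI : mould N k).
Proof.
apply/AltE; split=> // a b a0 b0; rewrite (eq_copr (P := 0)).
  by rewrite /copr big1.
by case: a b a0 b0 => [|x a] [|y b] // _ _ n nab; rewrite /mouldI nab addnS.
Qed.

Lemma symmetralM S T : symmetral S -> symmetral T -> symmetral (S * T).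
Proof.
move=> [S0 SE] [T0 TE]; split; last by rewrite coprM SE TE dmul_tens.
by rewrite mouldME big_ord_recl big_ord0 /= S0 T0 addr0 mulr1.
Qed.

Hypothesis k_char0 : [pchar k] =i pred0.

(** The binomial formula for the powers of M (x) 1 + 1 (x) M, whose two terms
    commute. *)
Lemma coprX M j : Alt M ->
  copr (M ^+ j) = \sum_(i < j.+1) tens (M ^+ i) (M ^+ (j - i)) *+ 'C(j, i).
Proof.
move=> /AltP ME; elim: j => [|j IHj].
  by rewrite big_ord_recl big_ord0 addr0 bin0 !expr0 copr1.
have dmul_sum A m (F : 'I_m -> dimould N k) :
    dmul A (\sum_(i < m) F i) = \sum_(i < m) dmul A (F i).
  apply: (big_morph (dmul A)); first exact: dmulDr.
  by have /eqP := dmulDr A 0 0; rewrite addr0 -subr_eq0 opprD addNKr oppr_eq0 => /eqP.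
have dmulMn A B m : dmul A (B *+ m) = dmul A B *+ m.
  elim: m => [|m IHm]; last by rewrite !mulrS dmulDr IHm.
  by have /eqP := dmulDr A 0 0; rewrite addr0 -subr_eq0 opprD addNKr oppr_eq0 => /eqP.
rewrite exprS coprM IHj ME dmulDl !dmul_sum.
under eq_bigr do rewrite dmulMn dmul_tens mul1r -exprS.
under [X in _ + X]eq_bigr do rewrite dmulMn dmul_tens mul1r -exprS.
rewrite [RHS]big_ord_recl bin0 [X in _ + X]big_ord_recl bin0 !subn0 !expr0.
rewrite addrCA; congr (_ + _).
under [RHS]eq_bigr do rewrite binS mulrnDr subSS.
rewrite big_split addrC [X in _ = X + _]big_ord_recr /= bin_small // mulr0n addr0.
congr (_ + _); apply: eq_bigr => i _; rewrite -subSn //.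
Qed.

(** By [coprX], the divided powers of M have the coproduct of the divided powers
    of a variable.  Encoding the values at a and at b of the exponential series
    as the coefficients of polynomials U and V, the value of the coproduct is
    that of U * V at 1. *)
Lemma mexp_symmetral M : Alt M -> symmetral (mexp M).
Proof.
move=> MA; split; first exact: mexp_nil.
apply/funext => a; apply/funext => b; pose m := (size a + size b)%N.
have M0 := Alt_nil MA.
pose U := \poly_(i < (size a).+1) (i`!%:R^-1 * (M ^+ i) a).
pose V := \poly_(i < (size b).+1) (i`!%:R^-1 * (M ^+ i) b).
have UE i : U`_i = i`!%:R^-1 * (M ^+ i) a.
  by rewrite coef_poly ltnS; case: leqP => // ai; rewrite mouldX_eq0 ?mulr0.
have VE i : V`_i = i`!%:R^-1 * (M ^+ i) b.
  by rewrite coef_poly ltnS; case: leqP => // ai; rewrite mouldX_eq0 ?mulr0.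
have -> : copr (mexp M) a b = \sum_(j < m.+1) j`!%:R^-1 * copr (M ^+ j) a b.
  rewrite /copr; under [RHS]eq_bigr do rewrite mulr_sumr.
  rewrite exchange_big; apply: eq_big_seq => n /shuffles_perm/perm_size.
  by rewrite size_cat => nm; apply: mexpE; rewrite ?nm.
have -> : tens (mexp M) (mexp M) a b = (U * V).[1].
  rewrite hornerM /tens !(mexpE M0 (leqnn _)) !horner_poly.
  by congr (_ * _); apply: eq_bigr => i _; rewrite expr1n mulr1.
rewrite (@horner_coef_wide _ m.+1); last first.
  apply: leq_trans (size_polyMleq _ _) _; rewrite -subn1 leq_subLR.
  by apply: leq_trans (leq_add (size_poly _ _) (size_poly _ _)) _; rewrite addSn addnS.
apply: eq_bigr => j _; rewrite expr1n mulr1 coefM coprX // .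
rewrite (big_morph (fun A : dimould N k => A a b) (id1 := 0) (op1 := +%R)) //.
rewrite mulr_sumr; apply: eq_bigr => i _; rewrite UE VE.
have ij : (i <= j)%N by rewrite -ltnS.
have MnE A c : (A *+ c : dimould N k) a b = A a b *+ c.
  by elim: c => // c IHc; rewrite !mulrS dimouldDE IHc.
have C_neq0 : 'C(j, i)%:R != 0 :> k.
  by rewrite (pcharf0P k).1 // -lt0n bin_gt0.
rewrite -(bin_fact ij) !natrM !invfM MnE -[in LHS]mulr_natl /tens.
by field; rewrite C_neq0 !factf_neq0.
Qed.

Definition trunc r M : mould N k := fun n => if (size n < r)%N then M n else 0.

Lemma trunc_vanish r M : vanish r (M - trunc r M).
Proof. by move=> n nr; rewrite mouldBE /trunc nr subrr. Qed.

(** Let G = mlog S, and suppose that H, the part of G of length less than r, is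
    alternal.  Then e^(-H) S is symmetral and equal to 1 + (G - H) up to terms
    of length more than r; as this has no term of length between 1 and r - 1,
    symmetrality at words a and b of total length r says that the coproduct of
    G vanishes there.  So H extended to length r is still alternal. *)
Lemma mlog_Alt S : symmetral S -> Alt (mlog S).
Proof.
move=> Ssym; have [S0 SE] := Ssym; set G := mlog S.
have G0 : G [::] = 0 := mlog_nil S.
apply: Alt_closed => r; exists (trunc r G); last exact: trunc_vanish.
case: r => [|r]; first exact: Alt0.
elim: r => [|r HA].
  rewrite (_ : trunc 1 G = 0); first exact: Alt0.
  by apply/funext => -[|x n]; rewrite /trunc.
move: (r.+1) (ltn0Sn r) HA => {}r r_gt0 HA; set H := trunc r G in HA *.
have GHr : vanish r (G - H) := @trunc_vanish _ _.
pose D := mexp (- H) * S - 1 - (G - H).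
have D0 : vanish r.+1 D.
  have := mexp_sub r_gt0 G0 (Alt_nil HA) GHr; rewrite mlogK // => eS.
  have -> : D = mexp (- H) * (S - mexp H - (G - H)) + (mexp (- H) - 1) * (G - H).
    by rewrite mulrBr mulrBr mexpNM ?(Alt_nil HA) // mulrBl mul1r addrA subrK.
  apply: vanishD; first exact: vanishMl.
  rewrite -add1n; apply: vanishM => //; apply/vanish1P.
  by rewrite mouldBE mexp_nil mould1E subrr.
have [_ PE] : symmetral (mexp (- H) * S).
  by apply: symmetralM => //; apply/mexp_symmetral/AltN.
set P := _ * S in PE.
have P0 a : a != [::] -> (size a < r)%N -> P a = 0.
  move=> a0 ar; have := D0 a (leqW ar); rewrite /D mouldBE GHr // subr0 mouldBE.
  by rewrite mould1E (negPf a0) subr0.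
have [_ HE] := (AltE H).1 HA.
apply/AltE; split=> [|a b a0 b0]; first by rewrite /trunc /= G0.
have [abr|rab|abr] := ltngtP (size a + size b)%N r.
- rewrite -(HE a b a0 b0); apply: eq_copr => n nab.
  by rewrite /H /trunc nab abr (leqW abr).
- rewrite (eq_copr (P := 0)) => [|n nab]; last first.
    by rewrite /trunc nab ltnNge rab.
  by rewrite /copr big1.
rewrite (eq_copr (P := P - 1)) => [|n nab].
  rewrite coprD coprN dimouldDE dimouldNE PE copr1 /tens mould1E (negPf a0) mul0r.
  rewrite subr0 P0 ?mul0r // -abr -[X in (X < _)%N]addn0 ltn_add2l.
  by rewrite lt0n size_eq0.
rewrite /trunc nab abr ltnSn; have := D0 n; rewrite nab abr ltnSn => /(_ isT)/eqP.
rewrite /D mouldBE subr_eq0 => /eqP ->.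
by rewrite mouldBE /H /trunc nab abr ltnn subr0.
Qed.

(** The coproduct of S and S (x) S solve the same Euler equation in two words,
    with the same constant term. *)
Lemma nabla1_symmetral S P : S [::] = 1 -> Alt P -> nabla (fun=> 1) S = S * P ->
  symmetral S.
Proof.
move=> S1 PA SE; split=> //; apply/funext => a; apply/funext => b.
have PE := (AltP P).1 PA; have P0 := Alt_nil PA.
move: {2}(size a + size b)%N (leqnn (size a + size b)) => m.
elim: m a b => [|m IHm] a b abm.
  have /eqP : (size a + size b == 0)%N by rewrite -leqn0.
  case: a b {abm} => [|//] [|//] _.
  by rewrite copr0s /tens S1 mulr1.
case: (posnP (size a + size b)) => [|ab_gt0].
  case: a b {abm} => [|//] [|//] _.
  by rewrite copr0s /tens S1 mulr1.
have ab_neq0 : (size a + size b)%:R != 0 :> k.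
  by rewrite -(prednK ab_gt0) natrS_neq0.
apply: (mulfI ab_neq0).
have -> : (size a + size b)%:R * copr S a b = dmul (copr S) (copr P) a b.
  rewrite -coprM -SE /copr mulr_sumr; apply: eq_big_seq => n /shuffles_perm/perm_size.
  by rewrite size_cat nabla1E => ->.
have -> : (size a + size b)%:R * tens S S a b = dmul (tens S S) (copr P) a b.
  rewrite PE dmulDr !dmul_tens !mulr1 -SE dimouldDE /tens !nabla1E natrD.
  by rewrite mulrDl mulrA mulrCA.
apply: eq_bigr => i _; apply: eq_bigr => j _.
have [i_le j_le] : (i <= size a)%N /\ (j <= size b)%N by split; rewrite -ltnS.
have [ij|ij] := ltnP (i + j)%N (size a + size b)%N.
  rewrite IHm // !size_takel //.
  by rewrite -ltnS (leq_trans ij).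
suff -> : copr P (drop i a) (drop j b) = 0 by rewrite !mulr0.
have ia : i = size a :> nat.
  by apply/eqP; rewrite eqn_leq i_le -(leq_add2r (size b)) (leq_trans ij) ?leq_add2l.
have jb : j = size b :> nat.
  by apply/eqP; rewrite eqn_leq j_le; move: ij; rewrite ia leq_add2l.
by rewrite ia jb !drop_size copr0s.
Qed.

End Alternal.

(** * Resonance and the gauge action *)

Section Resonance.
Variables (N : choiceType) (k : fieldType) (lam : N -> k).
Implicit Types (A F G J M P Q R S T : mould N k) (n : seq N).

Lemma resonantP M : nabla lam M = 0 <-> forall n, word_sum lam n != 0 -> M n = 0.
Proof.
split=> [M0 n n0|M0].
  have /eqP := congr1 (fun P : mould N k => P n) M0.
  by rewrite nablaE mulf_eq0 (negPf n0) => /eqP.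
apply/funext => n; rewrite nablaE; have [->|/M0 ->] := eqVneq (word_sum lam n) 0.
  by rewrite mul0r.
by rewrite mulr0.
Qed.

Lemma resonantM M P : nabla lam M = 0 -> nabla lam P = 0 -> nabla lam (M * P) = 0.
Proof. by move=> M0 P0; rewrite nablaM M0 P0 mulr0 mul0r addr0. Qed.

Lemma resonantN M : nabla lam M = 0 -> nabla lam (- M) = 0.
Proof. by rewrite -sub0r nablaB => ->; rewrite subr0; apply/funext => n; apply: mulr0. Qed.

Lemma resonantX M j : nabla lam M = 0 -> nabla lam (M ^+ j) = 0.
Proof.
move=> M0; elim: j => [|j IHj]; first exact: nabla_one.
by rewrite exprS resonantM.
Qed.

Lemma resonant_mexp M : nabla lam M = 0 -> nabla lam (mexp M) = 0.
Proof.
move=> M0; apply/resonantP => n n0; have /resonantP one0 := nabla_one lam.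
rewrite /mexp one0 // add0r big1 // => j _.
by have /resonantP -> := resonantX j M0; rewrite ?mulr0.
Qed.

Lemma resonant_mlog M : nabla lam M = 0 -> nabla lam (mlog M) = 0.
Proof.
move=> M0; apply/resonantP => n n0.
have X0 : nabla lam (M - 1) = 0 by rewrite nablaB nabla_one M0 subrr.
rewrite /mlog big1 // => j _.
by have /resonantP -> := resonantX j X0; rewrite ?mulr0.
Qed.

Lemma resonant_nabla1 M : nabla lam M = 0 -> nabla lam (nabla (fun=> 1) M) = 0.
Proof. by move=> M0; rewrite nablaC M0; apply/funext => n; apply: mulr0. Qed.

Lemma res_part_id M : nabla lam M = 0 -> res_part lam M = M.
Proof.
by move=> /resonantP M0; apply/funext => n; rewrite /res_part; case: eqP => // /eqP/M0.
Qed.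

Lemma res_partD M P : res_part lam (M + P) = res_part lam M + res_part lam P.
Proof.
by apply/funext => n; rewrite mouldDE /res_part; case: ifP; rewrite ?addr0.
Qed.

(** A resonant left factor only contributes through prefixes of weight zero,
    which do not change the weight of the rest of the word. *)
Lemma res_partMl P M : nabla lam P = 0 -> res_part lam (P * M) = P * res_part lam M.
Proof.
move=> /resonantP P0; apply/funext => n; rewrite /res_part -[M in RHS]/M !mouldME.
case: eqP => n0.
  apply: eq_bigr => i _; case: eqP => // d0; rewrite P0 ?mul0r //.
  apply/eqP => t0; apply: d0; move: n0.
  by rewrite -{1}(cat_take_drop i n) word_sum_cat t0 add0r.
rewrite big1 // => i _; case: eqP => d0; last by rewrite mulr0.
rewrite P0 ?mul0r //; apply/eqP => t0; apply: n0.
by rewrite -(cat_take_drop i n) word_sum_cat t0 d0 addr0.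
Qed.

Lemma res_partMr P M : nabla lam P = 0 -> res_part lam (M * P) = res_part lam M * P.
Proof.
move=> /resonantP P0; apply/funext => n; rewrite /res_part !mouldME.
case: eqP => n0.
  apply: eq_bigr => i _; case: eqP => // d0; rewrite P0 ?mulr0 //.
  apply/eqP => t0; apply: d0; move: n0.
  by rewrite -{1}(cat_take_drop i n) word_sum_cat t0 addr0.
rewrite big1 // => i _; case: eqP => d0; last by rewrite mul0r.
rewrite P0 ?mulr0 //; apply/eqP => t0; apply: n0.
by rewrite -(cat_take_drop i n) word_sum_cat t0 d0 addr0.
Qed.

(** At a word of nonzero weight, a nonzero term of F * S or S * F' has a factor F
    or F' on a nonempty piece of weight zero, so that S is taken at a shorter
    word of nonzero weight. *)
Lemma ode_resonant F F' S : vanish 1 F -> vanish 1 F' ->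
  nabla lam F = 0 -> nabla lam F' = 0 ->
  nabla lam S = F * S - S * F' -> nabla lam S = 0.
Proof.
move=> F1 F'1 /resonantP F0 /resonantP F'0 SE; apply/resonantP => n.
move: {2}(size n) (leqnn (size n)) => m; elim: m n => [|m IHm] n nm n0.
  by case: n nm n0 => // _; rewrite word_sum_nil eqxx.
apply: (mulfI n0); rewrite mulr0 -nablaE SE mouldBE !mouldME !big1 ?subrr // => i _.
  have i_le : (i <= size n)%N by rewrite -ltnS.
  have [d0|d0] := eqVneq (word_sum lam (drop i n)) 0; last by rewrite F'0 ?mulr0.
  have [ni|ni] := leqP (size n) i; first by rewrite drop_oversize // F'1 ?mulr0.
  rewrite IHm ?mul0r //; first by rewrite size_takel // -ltnS (leq_trans ni).
  by move: n0; rewrite -{1}(cat_take_drop i n) word_sum_cat d0 addr0.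
have [d0|d0] := eqVneq (word_sum lam (take i n)) 0; last by rewrite F0 ?mul0r.
have [->|i0] := posnP i; first by rewrite take0 F1 ?mul0r.
rewrite IHm ?mulr0 //; first by rewrite size_drop leq_subLR (leq_trans nm) // -add1n leq_add2r.
by move: n0; rewrite -{1}(cat_take_drop i n) word_sum_cat d0 add0r.
Qed.

Hypothesis k_char0 : [pchar k] =i pred0.

Lemma mexpN_unique G T : G [::] = 0 -> T * mexp G = 1 -> mexp (- G) = T.
Proof.
by move=> G0 TG; rewrite -[RHS]mulr1 -(mexpMN k_char0 G0) mulrA TG mul1r.
Qed.

Lemma mulM_nil M P : (M * P) [::] = M [::] * P [::].
Proof. by rewrite mouldME big_ord_recl big_ord0 addr0. Qed.

Section Gauge.
Variables (G J : mould N k).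
Hypotheses (G0 : G [::] = 0) (J0 : J [::] = 0).

Lemma mexp_mlogM : mexp (mlog (mexp G * mexp J)) = mexp G * mexp J.
Proof. by rewrite mlogK // mulM_nil !mexp_nil mulr1. Qed.

Lemma mexpN_mlogM : mexp (- mlog (mexp G * mexp J)) = mexp (- J) * mexp (- G).
Proof.
apply: mexpN_unique; first exact: mlog_nil.
by rewrite mexp_mlogM -mulrA (mulrA _ (mexp G)) mexpNM // mul1r mexpNM.
Qed.

Lemma gauge_genM : nabla lam J = 0 ->
  gauge_gen lam (mlog (mexp G * mexp J)) =
  mexp (- J) * gauge_gen lam G * mexp J + mexp (- J) * nabla (fun=> 1) (mexp J).
Proof.
move=> Jr; have eJ := resonant_mexp Jr; have eNJ := resonant_mexp (resonantN Jr).
rewrite /gauge_gen mexp_mlogM mexpN_mlogM nablaM mulrDr res_partD; congr (_ + _).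
  by rewrite -res_partMl // -res_partMr // !mulrA.
rewrite -mulrA (mulrA (mexp (- G))) mexpNM // mul1r res_part_id //.
by apply: resonantM => //; apply: resonant_nabla1.
Qed.

End Gauge.

Lemma gauge_set_bij F G : Alt F -> Alt G -> mould_eqn lam F G ->
  set_bij (Alt_res lam) (alt_solutions lam)
    (fun J : mould N k => (mexp (- J) * F * mexp J, mlog (mexp G * mexp J))).
Proof.
move=> FA GA [F0 GE]; have G0 := Alt_nil GA; split.
- move=> J [JA J0]; have Jn := Alt_nil JA; split=> /=.
  + apply: Alt_conj => //; [exact: mexp_symmetral | | exact: mexpNM].
    exact/mexp_symmetral/AltN.
  + by apply/mlog_Alt/symmetralM => //; apply: mexp_symmetral.
  have eJ := resonant_mexp J0; split.
    by rewrite !resonantM //; apply/resonant_mexp/resonantN.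
  rewrite mexp_mlogM // nablaM GE eJ mulr0 addr0 mulrBl !mulrA; congr (_ - _ * _).
  by rewrite -(mulrA (mexp G)) mexpMN // mulr1.
- move=> J J' /set_mem[/Alt_nil Jn _] /set_mem[/Alt_nil J'n _] [_ /(congr1 (@mexp N k))].
  rewrite !mexp_mlogM // => /(congr1 (fun M => mexp (- G) * M)).
  by rewrite !mulrA mexpNM // !mul1r; apply: mexp_inj.
move=> [F' G'] [/= F'A G'A [F'0 G'E]]; have G'n := Alt_nil G'A.
pose S := mexp (- G) * mexp G'.
have GS : mexp G * S = mexp G' by rewrite mulrA mexpMN // mul1r.
have Ssym : symmetral S.
  by apply: symmetralM; apply: mexp_symmetral => //; apply: AltN.
clearbody S; have SE : nabla lam S = F * S - S * F'.
  have : mexp G * nabla lam S = mexp G * (F * S - S * F').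
    have := G'E; rewrite -GS nablaM GE mulrBl mulrBr !mulrA => /(canRL (addKr _)) ->.
    by rewrite opprB addrA subrK.
  move/(congr1 (fun M => mexp (- G) * M)).
  by rewrite !mulrA mexpNM // !mul1r.
have S0 : nabla lam S = 0 by apply: ode_resonant SE => //; apply: Alt_vanish.
have S1 : S [::] = 1 by case: Ssym.
have Jn := mlog_nil S; exists (mlog S).
  by split; [apply: mlog_Alt | apply: resonant_mlog].
rewrite mlogK // GS mexpK //; congr (_, _); rewrite -mulrA.
have /eqP := SE; rewrite S0 eq_sym subr_eq0 => /eqP ->.
by rewrite mulrA -{2}(mlogK k_char0 S1) mexpNM // mul1r.
Qed.

End Resonance.

(** * Existence of a solution with a given gauge generator *)

Section Existence.
Variables (N : choiceType) (k : fieldType) (lam : N -> k).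
Hypothesis k_char0 : [pchar k] =i pred0.
Implicit Types (F G M P R S T : mould N k).

(** The solution is chosen as a function of P in order to be iterated in
    [solution_exists]. *)
Lemma nabla1_mexp_ode : exists L : mould N k -> mould N k, forall P, P [::] = 0 ->
  L P [::] = 0 /\ nabla (fun=> 1) (mexp (L P)) = mexp (L P) * P.
Proof.
have solvable P : exists L : mould N k, P [::] = 0 ->
    L [::] = 0 /\ nabla (fun=> 1) (mexp L) = mexp L * P; last first.
  by have [L LP] := choice solvable; exists L.
have [P0|P0] := eqVneq (P [::]) 0; last first.
  by exists 0 => P0'; rewrite P0' eqxx in P0.
have [S S1 SE] := nabla1_ode k_char0 ((vanish1P P).2 P0).
by exists (mlog S) => _; rewrite mlogK // mlog_nil.
Qed.

(** In the proof, [f] and [g] recover F and P from R, dividing by the length on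
    words of weight zero and by the weight on the others. *)
Lemma solution_exists A : Alt_res lam A -> exists FG : mould N k * mould N k,
  [/\ Alt FG.1, Alt FG.2, mould_eqn lam FG.1 FG.2 & gauge_gen lam FG.2 = A].
Proof.
move=> [AA A0]; have [L LP] := nabla1_mexp_ode.
pose f R : mould N k :=
  fun n => (if word_sum lam n == 0 then (size n)%:R^-1 else 0) * R n.
(* On words of weight zero the added term is 0, because 0^-1 = 0. *)
pose g R : mould N k := A + (fun n => (word_sum lam n)^-1 * R n : k).
have fA R : Alt R -> Alt (f R).
  by apply: Alt_weight => s n sn; rewrite /word_sum (perm_big _ sn) (perm_size sn).
have gA R : Alt R -> Alt (g R).
  move=> RA; apply: AltD => //; apply: Alt_weight RA => s n sn.
  by rewrite /word_sum (perm_big _ sn).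
have LA R : Alt R -> Alt (L (g R)).
  move=> /gA PA; have [L0 LE] := LP _ (Alt_nil PA).
  rewrite -[L _](mexpK k_char0) //; apply: mlog_Alt => //.
  by apply: nabla1_symmetral LE; rewrite ?mexp_nil.
pose Phi R := mexp (- L (g R)) * mouldI * mexp (L (g R)) + (f R * g R - g R * f R).
have PhiA R : Alt R -> Alt (Phi R).
  move=> RA; apply: AltD; last by apply: Alt_bracket; [apply: fA | apply: gA].
  apply: Alt_conj.
  - exact/mexp_symmetral/LA.
  - exact/mexp_symmetral/AltN/LA.
  - by apply: mexpNM => //; apply/Alt_nil/LA.
  exact: Alt_I.
have fgB R R' r : vanish r (R - R') -> vanish r (f R - f R') /\ vanish r (g R - g R').
  move=> RR'; split=> n /RR' /eqP; rewrite !mouldBE subr_eq0 => /eqP nR.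
    by rewrite /f nR subrr.
  by rewrite /g !mouldDE nR subrr.
have causal r R R' : Alt R -> Alt R' -> vanish r (R - R') ->
    vanish r.+1 (Phi R - Phi R').
  move=> RA R'A /fgB[fr gr].
  have f1 := Alt_vanish (fA _ RA); have g1 := Alt_vanish (gA _ RA).
  have f1' := Alt_vanish (fA _ R'A); have g1' := Alt_vanish (gA _ R'A).
  have [L0 LE] := LP _ (Alt_nil (gA _ RA)).
  have [L0' LE'] := LP _ (Alt_nil (gA _ R'A)).
  have Sr : vanish r (mexp (L (g R)) - mexp (L (g R'))).
    have Y1 : vanish 1 (mexp (L (g R)) - mexp (L (g R'))).
      by apply/vanish1P; rewrite mouldBE !mexp_nil subrr.
    apply: (euler_vanish k_char0 Y1 g1 (Q := 0)) => //.
    rewrite mul0r addr0 nablaB LE LE' mulrBl opprB addrC addrA subrK.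
    by rewrite -mulrBr; apply: vanishMl.
  have TI : vanish r.+1 (mexp (- L (g R)) * mouldI - mexp (- L (g R')) * mouldI).
    rewrite -mulrBl -addn1; apply: vanishM (Alt_vanish (@Alt_I _ _)).
    have -> : mexp (- L (g R)) - mexp (- L (g R')) =
        - (mexp (- L (g R)) * (mexp (L (g R)) - mexp (L (g R'))) * mexp (- L (g R'))).
      by rewrite mulrBr mulrBl mexpNM // mul1r -mulrA mexpMN // mulr1 opprB.
    exact/vanishN/vanishMr/vanishMl.
  rewrite /Phi opprD addrACA; apply: vanishD.
    rewrite mulrBB; apply: vanishD; last exact: vanishMr.
    rewrite -add1n; apply: vanishM => //; apply: vanishMl.
    exact: Alt_vanish (@Alt_I _ _).
  by rewrite opprD addrACA -opprD -add1n; apply: vanishB; apply: vanish_subM.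
have [M appr||R RA RE] := @causal_fixpoint _ _ Alt Phi 0 _ PhiA _ causal.
- exact: Alt_closed.
- exact: Alt0.
have [L0 SE] := LP _ (Alt_nil (gA _ RA)).
have [FA PA GA] : [/\ Alt (f R), Alt (g R) & Alt (L (g R))].
  by split; [apply: fA | apply: gA | apply: LA].
have gE : nabla (fun=> 1) (f R) + nabla lam (g R) = R.
  rewrite /g nablaD A0 add0r; apply/funext => n; rewrite mouldDE nabla1E nablaE /f.
  case: eqP => [->|/eqP n0]; last by rewrite mul0r mulr0 add0r mulVKf.
  rewrite mul0r addr0; case: n => [|x n]; first by rewrite mul0r (Alt_nil RA).
  by rewrite mulVKf ?natrS_neq0.
have F0 : nabla lam (f R) = 0.
  by apply/resonantP => n /negPf n0; rewrite /f n0 mul0r.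
have gA0 : res_part lam (g R) = A.
  rewrite res_partD res_part_id // -[RHS]addr0; congr (_ + _).
  by apply/funext => n; rewrite /res_part; case: eqP => // ->; rewrite invr0 mul0r.
move: RE gE; rewrite /Phi; set F := f R in FA F0 *; set P := g R in SE PA gA0 L0 GA *.
set G := L P in SE L0 GA *; clearbody F P G => RE gE; exists (F, G); split=> //=.
  split=> //; apply/eqP; rewrite -subr_eq0; apply/eqP.
  (* The defect of the equation solves nabla_1 D = D * P. *)
  apply: (euler_unique k_char0 (P := P) (Q := 0)) => //.
  - apply/vanish1P; rewrite mouldBE nablaE word_sum_nil mul0r mouldBE !mulM_nil.
    by rewrite (Alt_nil FA) mulr0 (Alt_nil (@Alt_I _ _)) mul0r subrr subrr.
  - exact: Alt_vanish.
  have key : mexp G * nabla lam P + mexp G * nabla (fun=> 1) F =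
      mouldI * mexp G + mexp G * F * P - mexp G * P * F.
    rewrite -mulrDr addrC gE -RE mulrDr mulrBr !mulrA mexpMN // mul1r.
    by rewrite addrA.
  rewrite mul0r addr0 !nablaB nablaC SE !nablaM SE nabla1_I !mulrBl.
  rewrite !mulrA opprD.
  (* What remains is linear in products of moulds: it can be checked in k, at
     each word, where commutative normalisation applies. *)
  apply/funext => n; have := congr1 (fun M => M n) key.
  rewrite !(mouldDE, mouldNE) => /(canRL (addrK _)) ->.
  by ring.
by rewrite /gauge_gen SE mulrA mexpNM // mul1r.
Qed.

End Existence.

(** * The theorem *)
Theorem theorem2 (N : choiceType) (k : fieldType) (lam : N -> k)
    (N_nonempty : inhabited N) (k_char0 : [pchar k] =i pred0) :
  (forall A : mould N k, Alt_res lam A ->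
     exists! FG : mould N k * mould N k,
       [/\ Alt FG.1, Alt FG.2, mould_eqn lam FG.1 FG.2
         & gauge_gen lam FG.2 = A])
  /\
  (forall F G : mould N k, Alt F -> Alt G -> mould_eqn lam F G ->
     set_bij (Alt_res lam) (alt_solutions lam)
       (fun J : mould N k =>
          (mexp (- J) * F * mexp J, mlog (mexp G * mexp J)))
     /\
     (forall J : mould N k, Alt_res lam J ->
        gauge_gen lam (mlog (mexp G * mexp J))
        = mexp (- J) * gauge_gen lam G * mexp J
          + mexp (- J) * nabla (fun=> 1) (mexp J))).
Proof.
split=> [A AA|F G FA GA FG]; last first.
  split; first exact: gauge_set_bij.
  by move=> J [JA J0]; apply: gauge_genM => //; apply: Alt_nil.
have [[F G] /= [FA GA FG AE]] := solution_exists k_char0 AA.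
exists (F, G); split=> // -[F' G'] /= [F'A G'A FG' A'E].
have [_ _ surj] := gauge_set_bij k_char0 FA GA FG.
have [|J [JA J0] [F'E G'E]] := surj (F', G'); first by split.
have G0 := Alt_nil GA; have Jn := Alt_nil JA.
have gE : nabla (fun=> 1) (mexp J) = mexp J * A - A * mexp J.
  have := gauge_genM k_char0 G0 Jn J0; rewrite G'E A'E AE.
  move=> /(congr1 (fun M => mexp J * M)); rewrite mulrDr !mulrA mexpMN // !mul1r.
  by move=> ->; rewrite addrC addKr.
have eJ1 : mexp J = 1.
  (* e^J - 1 solves the Euler equation with P = A and Q = - A. *)
  apply/eqP; rewrite -subr_eq0; apply/eqP.
  apply: (euler_unique k_char0 (P := A) (Q := - A)).
  - by apply/vanish1P; rewrite mouldBE mexp_nil mould1E subrr.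
  - by case: AA => /Alt_vanish.
  - by case: AA => /AltN/Alt_vanish.
  rewrite nablaB nabla_one subr0 gE mulrBl mulrBr !mulNr mul1r mulr1 opprK.
  by rewrite [X in _ = _ + X]addrC addrA subrK.
have eNJ1 : mexp (- J) = 1 by rewrite -[LHS]mulr1 -eJ1 mexpNM.
by rewrite -F'E -G'E eJ1 eNJ1 mul1r !mulr1 mexpK.
Qed.
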